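(* Let $N,k\ge1$ be integers and let $x_1,\dots,x_k$ be nonzero complex numbers with $x_i\neq x_j$ and $x_ix_j\ne1$ for $i<j$. Then $$\mathbb{E}_{g\in\mathrm{SO}(2N+1)}\prod_{j=1}^k\det(I-x_jg)=(x_1\cdots x_k)^N\prod_{i=1}^k(1-x_i)\ \chi^{\mathrm{SO}(2k+1)}_{\langle N^k\rangle}(x_1^{\pm1},\dots,x_k^{\pm1},1)$$ $$=\sum_{\varepsilon\in\{\pm1\}^k}\mathrm{sgn}(\varepsilon)\prod_{j=1}^kx_j^{(N+1/2)(1-\varepsilon_j)}\prod_{1\le i<j\le k}\big(1-x_i^{\varepsilon_i}x_j^{\varepsilon_j}\big)^{-1}.$$
   Context: $\mathrm{SO}(2N+1)$ is the group of real orthogonal $(2N+1)\times(2N+1)$ matrices of determinant $1$, and $\mathbb{E}$ is the integral with respect to Haar probability measure. $\langle N^k\rangle$ is the partition $(N,\dots,N)$ with $k$ parts. For $\varepsilon\in\{\pm1\}^k$, $\mathrm{sgn}(\varepsilon)=\prod_j\varepsilon_j$; note $(N+1/2)(1-\varepsilon_j)\in\{0,2N+1\}$. For a partition $\lambda$ of length $\le k$, the irreducible character of $\mathrm{SO}(2k+1)$ labelled by $\lambda$ is the Laurent polynomial $$\chi_\lambda^{\mathrm{SO}(2k+1)}(x_1^{\pm1},\dots,x_k^{\pm1},1)=\frac{\det_{1\le i,j\le k}\big(x_j^{\lambda_i+k-i+1/2}-x_j^{-(\lambda_i+k-i+1/2)}\big)}{\det_{1\le i,j\le k}\big(x_j^{k-i+1/2}-x_j^{-(k-i+1/2)}\big)}.$$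 *)

(* Defs.v *)
From HB Require Import structures.
From mathcomp Require Import all_boot all_order all_algebra finmap.
From mathcomp Require Import all_classical all_reals all_analysis.
From mathcomp Require Import complex.

Set Implicit Arguments.
Unset Strict Implicit.
Unset Printing Implicit Defensive.

Import Order.TTheory GRing.Theory Num.Theory.
Import numFieldNormedType.Exports.

Local Open Scope classical_set_scope.
Local Open Scope complex_scope.
Local Open Scope ring_scope.

Definition SO (R : realType) (n : nat) : set 'M[R]_n :=
  [set g | g *m g^T = 1%:M /\ \det g = 1].

Definition borel_mx (R : realType) (n : nat) :=
  g_sigma_algebraType (@open 'M[R]_n).

(* SO(n) is closed and its Borel sets are the traces of those of the ambient
   matrix space, so a Borel probability measure on SO(n) is the same thing as
   one on the matrix space giving SO(n) full mass.  Left invariance then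
   determines the measure uniquely. *)
Definition is_SO_haar (R : realType) (n : nat)
    (mu : probability (borel_mx R n) R) : Prop :=
  mu (@SO R n) = 1%:E /\
  forall (g : 'M[R]_n) (A : set (borel_mx R n)), SO g -> measurable A ->
    mu [set g *m h | h in A] = mu A.

Definition SO_expectation (R : realType) (n : nat)
    (mu : probability (borel_mx R n) R) (f : 'M[R]_n -> R[i]) : R[i] :=
  (\int[mu]_(g in @SO R n) complex.Re (f g)) +i*
  (\int[mu]_(g in @SO R n) complex.Im (f g)).

(* Laurent polynomials in k variables over R[i], as finitely supported
   families of coefficients indexed by exponent vectors. *)
Definition laurent (R : realType) (k : nat) :=
  {fsfun {ffun 'I_k -> int} -> R[i] with 0}.

(* Meaningful only when all x j are nonzero. *)
Definition leval (R : realType) (k : nat) (P : laurent R k)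
    (x : 'I_k -> R[i]) : R[i] :=
  \sum_(e <- finsupp P) P e * \prod_(j < k) x j ^ e j.

(* The alternant det (x_j^{l_i+k-i+1/2} - x_j^{-(l_i+k-i+1/2)}) for i, j in
   1..k, written in square roots y_j of the x_j so that the exponents are the
   odd integers 2 (l_i + k - i) + 1; row indices are shifted to start at 0. *)
Definition SO_alternant (R : realType) (k : nat) (l : seq nat)
    (y : 'I_k -> R[i]) : R[i] :=
  \det (\matrix_(i < k, j < k)
    (y j ^+ (2 * (nth 0%N l i + (k - i.+1))).+1
     - y j ^- (2 * (nth 0%N l i + (k - i.+1))).+1)).

(* P is the Laurent polynomial given by the quotient of alternants.  At most
   one P qualifies, since the points where the denominator does not vanish are
   Zariski dense. *)
Definition is_SO_char (R : realType) (k : nat) (l : seq nat)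
    (P : laurent R k) : Prop :=
  forall y : 'I_k -> R[i], (forall j, y j != 0) ->
    SO_alternant [::] y != 0 ->
    leval P (fun j => y j ^+ 2) = SO_alternant l y / SO_alternant [::] y.

(* The irreducible character of SO(2k+1) labelled by the partition l (a
   nonincreasing sequence of length at most k) as a Laurent polynomial.  Being
   a polynomial, it also has a value at points such as x_j = 1 where both
   alternants vanish. *)
Definition SO_char (R : realType) (k : nat) (l : seq nat) : laurent R k :=
  xget ([fsfun] : laurent R k) [set P | is_SO_char l P].

(* A sign vector in {1,-1}^k is encoded by booleans, b standing for (-1)^b. *)
Definition eps (R : pzRingType) (b : bool) : R := (-1) ^+ b.

(* (N + 1/2) (1 - eps) *)
Definition half_exp (N : nat) (b : bool) : nat := if b then (2 * N).+1 else 0%N.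

(* Main.v *)
(* Let h(g) = \prod_j det (1 - x_j g), n = 2 N + 1 and
   W(x) = \prod_(i < j) (x_i - x_j) (1 - x_i x_j).
   By invariance, the integral of the Laplacian of h over SO(n) is 0, and this
   Laplacian can be written as a second order operator in x acting on h.
   Multiplication by W conjugates it to \sum_j (theta_j^2 - m theta_j) - c with
   theta_j = x_j d/dx_j and m = n + 2 (k - 1), so that W times the mean of h
   contains only monomials x^a with \sum_j a_j (a_j - m) = c.  It also changes
   sign when two variables are exchanged or when x_j is replaced by 1/x_j (with
   weight m), so that the half-integers |a_j - m/2| are distinct; being at most
   m/2 and having the largest possible sum of squares, they are
   m/2, m/2 - 1, ..., m/2 - (k - 1).  Hence W times the mean of h is the
   alternant det (x_j^i - x_j^(m - i)), up to a factor read off the lowest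
   coefficient.  Expanding its columns gives the sum over signs, and comparing
   with the case N = 0, which evaluates the Weyl denominator, gives the
   character. *)

Require Import Defs.
From HB Require Import structures.
From mathcomp Require Import all_boot all_order all_algebra finmap.
From mathcomp Require Import fingroup perm.
From mathcomp Require Import all_classical all_reals all_analysis.
From mathcomp Require Import measurable_realfun complex.
From mathcomp Require Import ring lra zify.

Set Implicit Arguments.
Unset Strict Implicit.
Unset Printing Implicit Defensive.

Import Order.TTheory GRing.Theory Num.Theory.
Import numFieldNormedType.Exports.

Local Open Scope classical_set_scope.
Local Open Scope complex_scope.
Local Open Scope ring_scope.

(** * Determinants *)

(** Nothing is differentiated on the group. A rotation R in a coordinate plane perturbs [1 - x g] by
    rank two, so det (1 - x R g) is affine in sin t and 1 - cos t. With the rational parametrisation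
    of the circle, invariance of the measure becomes an equality of polynomials in t, whose
    coefficient at t^2 is the vanishing of the mean Laplacian. Adjugates replace inverses, since
    [1 - x g] is singular for some x. W is the determinant of the values of polynomials w_i
    ([pal_basis]), so W h is an alternant in the products w_i p, with p = det (1 - X g), and its
    coefficients are determinants in the coefficients of p. The eigenvalue equation, obtained at
    real points off the zeros of W, passes to the means of these coefficients by interpolation on a
    grid, and from there to all complex x. The quotient defining the character says nothing directly
    where some x_j = 1, and a Laurent polynomial realising it must be produced: it comes from the
    mean itself, each det (1 - x g) being divisible by 1 - x in odd dimension. *)

Lemma deriv_prod (K : comNzRingType) (I : eqType) (r : seq I) (P : pred I)
    (F : I -> {poly K}) : uniq r ->
  (\prod_(i <- r | P i) F i)^`() =
  \sum_(i <- r | P i) (F i)^`() * \prod_(j <- r | P j && (j != i)) F j.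
Proof.
elim: r => [|a r IH] /=; first by rewrite !big_nil derivC.
case/andP=> ar /IH {}IH; rewrite !big_cons.
have rest i : i \in r -> \prod_(j <- a :: r | P j && (j != i)) F j =
    (if P a then F a else 1) * \prod_(j <- r | P j && (j != i)) F j.
  move=> ir; rewrite big_cons (_ : a != i); last first.
    by apply: contraNneq ar => ->.
  by case: (P a); rewrite ?mul1r.
have head : \prod_(j <- r | P j && (j != a)) F j = \prod_(j <- r | P j) F j.
  rewrite [LHS]big_seq_cond [RHS]big_seq_cond.
  apply: eq_bigl => j; case: (boolP (j \in r)) => //= jr.
  by rewrite (_ : j != a) ?andbT //; apply: contraNneq ar => <-.
have -> : \sum_(i <- r | P i) (F i)^`() * \prod_(j <- a :: r | P j && (j != i)) F j
   = (if P a then F a else 1) * (\prod_(j <- r | P j) F j)^`().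
  rewrite IH big_distrr /= [LHS]big_seq_cond [RHS]big_seq_cond.
  by apply: eq_bigr => i /andP[ir _]; rewrite rest // mulrCA.
case: (P a); last by rewrite mul1r.
by rewrite derivM eqxx andbF head.
Qed.

(** Jacobi's formula: differentiating one row at a time and expanding along that row gives the
    diagonal of the product with the adjugate, whether or not [A] is invertible. *)
Lemma deriv_det (K : comNzRingType) n (A : 'M[{poly K}]_n) :
  (\det A)^`() = \tr (map_mx (@deriv K) A *m \adj A).
Proof.
pose B (i0 : 'I_n) : 'M[{poly K}]_n :=
  \matrix_(i, j) if i == i0 then (A i j)^`() else A i j.
have -> : \tr (map_mx (@deriv K) A *m \adj A) = \sum_i \det (B i).
  apply: eq_bigr => i _; rewrite (expand_det_row _ i) !mxE.
  apply: eq_bigr => j _; rewrite !mxE eqxx; congr (_ * _).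
  rewrite /cofactor; congr (_ * \det _); apply/matrixP => a b.
  by rewrite !mxE eq_sym (negPf (neq_lift _ _)).
rewrite [X in X^`()]/determinant raddf_sum /= exchange_big /=.
apply: eq_bigr => s _.
have -> (p : {poly K}) : ((-1) ^+ odd_perm s * p)^`() = (-1) ^+ odd_perm s * p^`().
  by case: (odd_perm s); rewrite ?expr0 ?expr1 ?mul1r ?mulN1r ?derivN.
rewrite deriv_prod ?index_enum_uniq // big_distrr /=; apply: eq_bigr => i _.
rewrite [in RHS](bigD1 i) //=; congr (_ * _); rewrite mxE eqxx; congr (_ * _).
by apply: eq_bigr => j ji; rewrite mxE (negPf ji).
Qed.

(** Matrix determinant lemma with inverses cleared. Two eliminations compute the determinant of the
    block matrix [X]; the power of [\det B] brought in by the adjugate is then cancelled in the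
    domain [K], later a polynomial ring. *)
Lemma det_sub_rank2 (K : idomainType) n (B : 'M[K]_n) (U : 'M[K]_(n, 2))
    (V : 'M[K]_(2, n)) : \det B != 0 ->
  \det B * \det (B - U *m V) = \det ((\det B)%:M - V *m \adj B *m U).
Proof.
move=> B0; set p := \det B.
pose X := block_mx B U V 1%:M.
have detX : \det X = \det (B - U *m V).
  have E : X *m block_mx 1%:M 0 (- V) 1%:M = block_mx (B - U *m V) U 0 1%:M.
    rewrite mulmx_block !mulmx1 !mulmx0 !mul1mx !add0r mulmxN.
    by congr block_mx; rewrite addrN.
  have := congr1 determinant E.
  by rewrite det_mulmx det_lblock det_ublock !det1 !mulr1.
have E2 : block_mx (\adj B) 0 (- (V *m \adj B)) p%:M *m X =
    block_mx p%:M (\adj B *m U) 0 (p%:M - V *m \adj B *m U).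
  rewrite mulmx_block !mul0mx !addr0 !mulNmx mulmx1 -(mulmxA V _ B) mul_adj_mx.
  by rewrite mul_mx_scalar mul_scalar_mx addNr [- _ + _]addrC.
have := congr1 determinant E2.
rewrite det_mulmx det_lblock det_ublock !det_scalar detX => E3.
have adjn : \det (\adj B) * p = p ^+ n.
  by rewrite -det_mulmx mul_adj_mx det_scalar.
have : p ^+ n * (p * \det (B - U *m V)) =
       p ^+ n * \det (p%:M - V *m \adj B *m U).
  rewrite -E3 -adjn; ring.
by apply: mulfI; rewrite expf_neq0.
Qed.

Lemma det_mx2 (K : comNzRingType) (A : 'M[K]_2) :
  \det A = A 0 0 * A 1 1 - A 0 1 * A 1 0.
Proof.
have e1 : lift ord0 ord0 = 1 :> 'I_2 by exact/val_inj.
have e0 : lift (1 : 'I_2) ord0 = 0 :> 'I_2 by exact/val_inj.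
rewrite (expand_det_row _ ord0) big_ord_recl big_ord1 /cofactor !det_mx11.
rewrite e1 !mxE e1 e0 addn0 expr0 mul1r (_ : (ord0 + 1)%N = 1%N) // expr1.
by rewrite mulN1r mulrN.
Qed.

(** * Plane rotations and the polynomial det (1 - X g) *)

(* This is det (1 - x g) ((1 - x g)^-1 - 1), free of division. *)
Definition res_mx (K : comNzRingType) n (g : 'M[K]_n) (x : K) : 'M[K]_n :=
  x *: (g *m \adj (1%:M - x *: g)).

(** With s = sin t and q = 1 - cos t this is the rotation of angle t; the circle equation becomes
    s^2 + q^2 = 2 q. *)
Definition plane_rot (K : comNzRingType) n (a b : 'I_n) (s q : K) : 'M[K]_n :=
  1%:M + s *: (delta_mx a b - delta_mx b a)
    - q *: (delta_mx a a + delta_mx b b).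

Section PlaneRotation.
Variables (K : comNzRingType) (n : nat) (a b : 'I_n) (s q : K).

Let f (j : 'I_2) := if j == 0 then a else b.
Let U : 'M[K]_(n, 2) := \matrix_(i, j) (i == f j)%:R.
Let C : 'M[K]_2 :=
  \matrix_(i, j) if i == j then - q else if i == 0 then s else - s.

(** [U] includes the plane and [C] is the 2 x 2 rotation minus the identity. *)
Lemma rot_rank2 : plane_rot a b s q = 1%:M + U *m C *m U^T.
Proof.
rewrite /plane_rot -addrA; congr (_ + _); apply/matrixP => i j.
rewrite !mxE !big_ord_recl big_ord0 addr0 !mxE !big_ord_recl !big_ord0 !addr0.
rewrite !mxE /f /=.
case: (i == a); case: (j == a); case: (i == b); case: (j == b) => /=;
  rewrite ?andbT ?andbF /=; ring.
Qed.

Lemma mulmx_rot_embed (N : 'M[K]_n) :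
  U^T *m N *m U = \matrix_(i, j) N (f i) (f j).
Proof.
apply/matrixP => i j; rewrite !mxE (bigD1 (f j)) //= !mxE eqxx mulr1.
rewrite (bigD1 (f i)) //= !mxE eqxx mul1r big1 ?addr0; last first.
  by move=> l /negPf li; rewrite !mxE li mul0r.
by rewrite big1 ?addr0 // => l /negPf lj; rewrite !mxE lj mulr0.
Qed.

Hypothesis ab : a != b.

Lemma rot_embedK : U^T *m U = 1%:M.
Proof.
have := mulmx_rot_embed 1%:M; rewrite mulmx1 => ->.
apply/matrixP => i j; rewrite !mxE /f.
case: (unliftP 0 i) => [i'|] ->; case: (unliftP 0 j) => [j'|] ->;
  rewrite ?(ord1 i') ?(ord1 j') ?eqxx //= 1?eq_sym ?(negPf ab) //.
by rewrite eq_sym (negPf ab).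
Qed.

Hypothesis sq : s ^+ 2 + q ^+ 2 = q *+ 2.

Lemma rot_orthogonal : plane_rot a b s q *m (plane_rot a b s q)^T = 1%:M.
Proof.
rewrite rot_rank2 linearD /= trmx1 !trmx_mul trmxK mulmxDl !mulmxDr !mul1mx.
rewrite mulmx1 -!addrA; apply/eqP; rewrite addrC -subr_eq0 addrK.
have sq0 : s ^+ 2 + q ^+ 2 - q *+ 2 = 0 by rewrite sq subrr.
have CC : C^T + (C + C *m C^T) = 0.
  apply/matrixP => i j; rewrite !mxE !big_ord_recl big_ord0 addr0 !mxE.
  case: (unliftP 0 i) => [i'|] ->; case: (unliftP 0 j) => [j'|] ->;
    rewrite ?(ord1 i') ?(ord1 j') /=; first [ring | rewrite -[RHS]sq0; ring].
have -> : U *m C *m U^T *m (U *m (C^T *m U^T)) = U *m (C *m C^T) *m U^T.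
  by rewrite !mulmxA -(mulmxA (U *m C) U^T U) rot_embedK mulmx1 -!mulmxA.
by rewrite -mulmxDl mulmxA -mulmxDl -!mulmxDr CC mulmx0 mul0mx.
Qed.

End PlaneRotation.

Section PlaneRotationDet.
Variables (K : idomainType) (n : nat) (a b : 'I_n) (s q : K).
Hypothesis ab : a != b.
Hypothesis sq : s ^+ 2 + q ^+ 2 = q *+ 2.

(** The 2 x 2 minor of [N] enters with the factor det C = s^2 + q^2, which the circle equation turns
    into 2 q. Hence the result is affine in s and q. *)
Lemma det_rot_res (g : 'M[K]_n) (x : K) (p := \det (1%:M - x *: g))
    (N := res_mx g x) : p != 0 ->
  p * \det (1%:M - x *: (plane_rot a b s q *m g)) =
  p * (p - s * (N b a - N a b) + q * (N a a + N b b))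
  + q *+ 2 * (N a a * N b b - N a b * N b a).
Proof.
move=> p0; rewrite (rot_rank2 a b s q).
set U := (X in X *m _ *m X^T); set C := (X in _ *m X *m _).
have -> : 1%:M - x *: ((1%:M + U *m C *m U^T) *m g) =
    1%:M - x *: g - U *m (x *: (C *m U^T *m g)).
  by rewrite mulmxDl mul1mx scalerDr opprD addrA -scalemxAr !mulmxA.
rewrite det_sub_rank2 // -/p.
have -> : x *: (C *m U^T *m g) *m \adj (1%:M - x *: g) *m U
    = C *m (U^T *m N *m U).
  by rewrite /N /res_mx -!scalemxAl -!scalemxAr -!scalemxAl -?scalemxAr !mulmxA.
rewrite mulmx_rot_embed; clearbody N.
rewrite det_mx2 !mxE !big_ord_recl !big_ord0 !addr0 !mxE /=.
have sq0 : s ^+ 2 + q ^+ 2 - q *+ 2 = 0 by rewrite sq subrr.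
apply/eqP; rewrite -subr_eq0; apply/eqP.
rewrite -[RHS](mulr0 (N a a * N b b - N a b * N b a)) -[in RHS]sq0; ring.
Qed.

Lemma det_rot : \det (plane_rot a b s q) = 1.
Proof.
rewrite (rot_rank2 a b s q) -mulmxA -[X in \det X]mul1r.
set U := (X in X *m _); set C := (X in _ *m (X *m _)).
have := @det_sub_rank2 K n 1%:M U (- (C *m U^T)); rewrite det1 oner_eq0.
rewrite mulmxN opprK !mul1r => -> //.
have -> : \adj (1%:M : 'M[K]_n) = 1%:M by rewrite -[LHS]mul1mx mul_mx_adj det1.
rewrite mulmx1 mulNmx opprK -mulmxA rot_embedK // mulmx1 det_mx2 !mxE /=.
have sq0 : s ^+ 2 + q ^+ 2 - q *+ 2 = 0 by rewrite sq subrr.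
by rewrite -[RHS]addr0 -[in RHS]sq0; ring.
Qed.

End PlaneRotationDet.

(** * The polynomial det (1 - X g) and its variation under plane rotations *)

Section CharPoly.
Variables (K : numFieldType) (n : nat).
Implicit Types (g : 'M[K]_n).

Definition rcp g : {poly K} := \det (1%:M - 'X *: map_mx polyC g).

Definition res_poly g : 'M[{poly K}]_n := res_mx (map_mx polyC g) 'X.

Lemma horner_rcp (L : comNzRingType) (f : {rmorphism K -> L}) g (x : L) :
  (map_poly f (rcp g)).[x] = \det (1%:M - x *: map_mx f g).
Proof.
rewrite -[LHS]/((horner_eval x \o map_poly f) (rcp g)) -det_map_mx.
congr (\det _); apply/matrixP => i j; rewrite !mxE /= rmorphB rmorphM /=.
by rewrite rmorph_nat map_polyX map_polyC /= /horner_eval -polyC_natr !hornerE.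
Qed.

Lemma hornerE_rcp g x : (rcp g).[x] = \det (1%:M - x *: g).
Proof.
have := horner_rcp idfun g x; rewrite map_poly_id // => ->.
by rewrite map_mx_id.
Qed.

Lemma horner_res_poly g x i j : (res_poly g i j).[x] = res_mx g x i j.
Proof.
rewrite -[LHS]/(horner_eval x (res_poly g i j)).
have -> : horner_eval x (res_poly g i j) = map_mx (horner_eval x) (res_poly g) i j.
  by rewrite [RHS]mxE.
rewrite /res_poly /res_mx map_mxZ map_mxM map_mx_adj map_mxB map_mx1 map_mxZ.
have -> : map_mx (horner_eval x) (map_mx polyC g) = g.
  by apply/matrixP => u v; rewrite !mxE /horner_eval hornerC.
by rewrite /= /horner_eval hornerX.
Qed.

(** The constant term makes [rcp g] nonzero for every g, so it can be cancelled in the polynomial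
    ring even though its values may vanish. *)
Lemma rcp0 g : (rcp g)`_0 = 1.
Proof. by rewrite -horner_coef0 hornerE_rcp scale0r subr0 det1. Qed.

Lemma rcp_neq0 g : rcp g != 0.
Proof.
by apply: contraTneq (oner_neq0 K) => g0; rewrite -(rcp0 g) g0 coef0 eqxx.
Qed.

Lemma size_rcp g : (size (rcp g) <= n.+1)%N.
Proof.
apply: (leq_trans (size_sum _ _ _)); apply/bigmax_leqP => s _.
rewrite mulr_sign; apply: (@leq_trans (size (\prod_i
   (1%:M - 'X *: map_mx polyC g) i (perm.fun_of_perm s i)))).
  by case: ifP; rewrite ?size_polyN.
apply: (leq_trans (size_prod_leq _ _)); rewrite card_ord.
rewrite leq_subLR addnS ltnS (@leq_trans (\sum_(i < n) 2)) //.
  apply: leq_sum => i _; rewrite !mxE (leq_trans (size_polyD _ _)) // geq_max.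
  rewrite -polyC_natr size_polyN (leq_trans (size_polyC_leq1 _)) //=.
  by rewrite (leq_trans (size_polyMleq _ _)) // size_polyX add2n /= ltnS size_polyC_leq1.
by rewrite sum_nat_const card_ord muln2 addnn.
Qed.

Lemma deriv_1subX g :
  map_mx (@deriv K) (1%:M - 'X *: map_mx polyC g) = - map_mx polyC g.
Proof.
apply/matrixP => i j; rewrite !mxE -polyC_natr.
by rewrite derivB derivC derivM derivX derivC mul1r mulr0 addr0 sub0r.
Qed.

Lemma trace_res_poly g : \tr (res_poly g) = - ('X * (rcp g)^`()).
Proof.
rewrite /rcp deriv_det deriv_1subX mulNmx linearN mulrN opprK.
by rewrite /res_poly /res_mx mxtraceZ.
Qed.

(** A second use of Jacobi's formula needs the derivative of the adjugate; differentiating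
    [\adj B *m B = p%:M] gives p times that derivative, without division. *)
Lemma trace_res_poly_sqr g : \tr (res_poly g *m res_poly g) =
  'X ^+ 2 * ((rcp g)^`() ^+ 2 - rcp g * (rcp g)^`()^`()).
Proof.
rewrite /rcp; set G := map_mx polyC g; set B := 1%:M - 'X *: G.
set A := \adj B; set p := \det B.
have dB : map_mx (@deriv K) B = - G by apply: deriv_1subX.
have dM (C D : 'M[{poly K}]_n) : map_mx (@deriv K) (C *m D) =
    map_mx (@deriv K) C *m D + C *m map_mx (@deriv K) D.
  apply/matrixP => i j; rewrite !mxE raddf_sum -big_split /=.
  by apply: eq_bigr => l _; rewrite derivM !mxE.
have dp : p^`() = - \tr (G *m A) by rewrite /p deriv_det dB mulNmx linearN.
have dA : map_mx (@deriv K) A *m B = p^`()%:M + A *m G.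
  have := congr1 (map_mx (@deriv K)) (mul_adj_mx B); rewrite dM dB mulmxN.
  move/(canRL (subrK _)) => ->; congr (_ + _); apply/matrixP => i j.
  by rewrite !mxE; case: (i == j); rewrite ?mulr1n ?mulr0n ?raddf0.
have pdA : p *: map_mx (@deriv K) A = p^`() *: A + A *m G *m A.
  have := congr1 (mulmxr A) dA; rewrite /= mulmxDl mul_scalar_mx.
  by rewrite -(mulmxA _ B) mul_mx_adj mul_mx_scalar.
have ddp : p^`()^`() = - \tr (G *m map_mx (@deriv K) A).
  have dtr (C : 'M[{poly K}]_n) : (\tr C)^`() = \tr (map_mx (@deriv K) C).
    by rewrite raddf_sum; apply: eq_bigr => i _; rewrite mxE.
  have dG : map_mx (@deriv K) G = 0.
    by apply/matrixP => i j; rewrite !mxE derivC.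
  by rewrite dp derivN dtr dM dG mul0mx add0r.
have -> : \tr (res_poly g *m res_poly g) = 'X ^+ 2 * \tr (G *m A *m G *m A).
  rewrite (_ : res_poly g = 'X *: (G *m A)) // -scalemxAl -scalemxAr scalerA.
  by rewrite mxtraceZ -expr2 !mulmxA.
rewrite ddp mulrN opprK -[in RHS]mxtraceZ [in RHS]scalemxAr pdA mulmxDr linearD /= -scalemxAr.
rewrite mxtraceZ !mulmxA; congr (_ * _).
by rewrite dp sqrrN mulNr addrA expr2 addrN add0r.
Qed.

(* For a rotation of angle t in a coordinate plane, det (1 - x R g) is affine in
   s = sin t and q = 1 - cos t; [- rot_beta] and [rot_gamma] are the
   coefficients of s and q (lemma [rcp_rot]). *)
Definition rot_beta g a b : {poly K} := res_poly g b a - res_poly g a b.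

Definition rot_gamma g a b : {poly K} :=
  2^-1 *: (rcp (plane_rot a b 0 2 *m g) - rcp g).

Lemma rcp_rot_mul g a b (s q : K) : a != b -> s ^+ 2 + q ^+ 2 = q *+ 2 ->
  let N := res_poly g in
  rcp g * rcp (plane_rot a b s q *m g) =
  rcp g * (rcp g - s *: (N b a - N a b) + q *: (N a a + N b b))
  + (q *+ 2) *: (N a a * N b b - N a b * N b a).
Proof.
move=> ab sq N.
have sq' : s%:P ^+ 2 + q%:P ^+ 2 = q%:P *+ 2 :> {poly K}.
  by rewrite -!polyC_exp -polyCD sq polyCMn.
have := @det_rot_res {poly K} n a b s%:P q%:P sq' (map_mx polyC g) 'X.
rewrite -!mul_polyC polyCMn => /(_ (rcp_neq0 g)) <-; congr (_ * \det (_ - _ *: _)).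
rewrite map_mxM; congr (_ *m _).
by rewrite /plane_rot map_mxB map_mxD map_mx1 !map_mxZ map_mxB map_mxD !map_delta_mx.
Qed.

(** The half-turn s = 0, q = 2 isolates the coefficient of q. Defining [rot_gamma] from it makes it
    a polynomial at once, and the divisibility of the minor term by [rcp g] comes out as a
    consequence. *)
Lemma rcp_gamma g a b : a != b -> let N := res_poly g in
  rcp g * rot_gamma g a b =
  rcp g * (N a a + N b b) + 2 *: (N a a * N b b - N a b * N b a).
Proof.
move=> ab N; have sq2 : (0 : K) ^+ 2 + 2 ^+ 2 = 2 *+ 2 by ring.
rewrite /rot_gamma -scalerAr mulrBr rcp_rot_mul // -/N scale0r subr0 mulrDr.
rewrite addrAC [X in X + _]addrAC subrr add0r -scalerAr scalerDr !scalerA.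
by rewrite mulVf ?pnatr_eq0 // scale1r; congr (_ + _ *: _); field.
Qed.

Lemma rcp_rot g a b (s q : K) : a != b -> s ^+ 2 + q ^+ 2 = q *+ 2 ->
  rcp (plane_rot a b s q *m g) =
  rcp g - s *: rot_beta g a b + q *: rot_gamma g a b.
Proof.
move=> ab sq; apply: (mulfI (rcp_neq0 g)); rewrite rcp_rot_mul //.
rewrite [in RHS]mulrDr [in LHS]mulrDr -addrA; congr (_ + _).
rewrite -scalerAr -[in RHS]scalerAr rcp_gamma // [in RHS]scalerDr scalerA.
by rewrite mulr_natr.
Qed.

(** The minors add up to (tr N)^2 - tr (N^2), in which the squares of the first derivative cancel
    and a factor [rcp g] remains. Pairs (a, b) are ordered, hence the 2. *)
Lemma sum_rot_gamma g :
  \sum_a \sum_(b | b != a) rot_gamma g a b =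
  2 *: ('X ^+ 2 * (rcp g)^`()^`() - (n%:R - 1) *: ('X * (rcp g)^`())).
Proof.
apply: (mulfI (rcp_neq0 g)).
pose N := res_poly g; pose F a b : {poly K} := rcp g * (N a a + N b b)
  + 2 *: (N a a * N b b - N a b * N b a).
have -> : rcp g * \sum_a \sum_(b | b != a) rot_gamma g a b =
    \sum_a \sum_b F a b - \sum_a F a a.
  rewrite big_distrr /= -sumrB; apply: eq_bigr => a _.
  rewrite [X in X - _](bigD1 a) //= [X in X - _]addrC addrK big_distrr /=.
  by apply: eq_bigr => b ba; rewrite rcp_gamma // eq_sym.
have -> : \sum_a F a a = 2 *: (rcp g * \tr N).
  rewrite /mxtrace big_distrr /= scaler_sumr; apply: eq_bigr => a _.
  by rewrite /F subrr scaler0 addr0 -mulr2n mulrnAr scaler_nat.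
have -> : \sum_a \sum_b F a b = rcp g * (n%:R * \tr N + n%:R * \tr N)
    + 2 *: (\tr N * \tr N - \tr (N *m N)).
  have e1 : \sum_a \sum_(b < n) N a a = n%:R * \tr N.
    rewrite mulr_natl -sumrMnl; apply: eq_bigr => a _.
    by rewrite sumr_const card_ord.
  have e2 : \sum_(a < n) \sum_b N b b = n%:R * \tr N.
    by rewrite sumr_const card_ord mulr_natl.
  have e3 : \sum_a \sum_b N a a * N b b = \tr N * \tr N.
    by rewrite big_distrl /=; apply: eq_bigr => a _; rewrite big_distrr.
  have e4 : \sum_a \sum_b N a b * N b a = \tr (N *m N).
    by apply: eq_bigr => a _; rewrite mxE.
  rewrite -{1}e1 -{1}e2 -e3 -e4 -big_split -sumrB mulr_sumr scaler_sumr.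
  rewrite -big_split; apply: eq_bigr => a _.
  rewrite -big_split -sumrB mulr_sumr scaler_sumr -big_split.
  by apply: eq_bigr => b _.
rewrite /N trace_res_poly trace_res_poly_sqr -!mul_polyC polyCB polyC1 -!polyC_natr.
ring.
Qed.

End CharPoly.

(** * Products of two resolvents of an orthogonal matrix *)

Section Resolvent.
Variables (K : fieldType) (n : nat) (g : 'M[K]_n).

Lemma res_mxE x : res_mx g x = \adj (1%:M - x *: g) - (\det (1%:M - x *: g))%:M.
Proof.
by rewrite -mul_mx_adj mulmxBl mul1mx subKr /res_mx scalemxAl.
Qed.

Lemma mulmx_adj_comm x : x != 0 ->
  g *m \adj (1%:M - x *: g) = \adj (1%:M - x *: g) *m g.
Proof.
move=> x0; apply: (scalerI x0); rewrite [LHS]scalemxAl [RHS]scalemxAr.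
have := mul_adj_mx (1%:M - x *: g); rewrite -[in RHS]mul_mx_adj.
by rewrite mulmxBl mulmxBr mul1mx mulmx1 => /subrI.
Qed.

(** First resolvent identity with determinants cleared; it rests on (1 - y g) - (1 - x g) = (x - y)
    g. *)
Lemma resolvent_identity (x y : K) :
  (x - y) *: (res_mx g x *m res_mx g y) =
  (y * \det (1%:M - y *: g)) *: res_mx g x
  - (x * \det (1%:M - x *: g)) *: res_mx g y.
Proof.
set px := \det (1%:M - x *: g); set py := \det (1%:M - y *: g).
set Ax := \adj (1%:M - x *: g); set Ay := \adj (1%:M - y *: g).
have comm : g *m Ax = Ax *m g \/ x = 0.
  by have [->|x0] := eqVneq x 0; [right | left; apply: mulmx_adj_comm].
case: comm => [comm | x0]; last first.
  by rewrite /res_mx x0 !(scale0r, mul0mx, mul0r, scaler0) subrr.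
have -> : (y * py) *: res_mx g x =
    (x * y) *: (g *m (Ax *m ((1%:M - y *: g) *m Ay))).
  rewrite mul_mx_adj mul_mx_scalar -[in RHS]scalemxAr /res_mx !scalerA -/py.
  by congr (_ *: _); ring.
have -> : (x * px) *: res_mx g y =
    (x * y) *: (g *m (Ax *m ((1%:M - x *: g) *m Ay))).
  rewrite [Ax *m _]mulmxA mul_adj_mx mul_scalar_mx -[in RHS]scalemxAr /res_mx !scalerA -/px.
  by congr (_ *: _); ring.
rewrite -scalerBr -mulmxBr -mulmxBr -mulmxBl.
have -> : 1%:M - y *: g - (1%:M - x *: g) = (x - y) *: g.
  by rewrite opprB addrC addrA subrK scalerBl.
rewrite -[in RHS]scalemxAl -![in RHS]scalemxAr [in RHS]scalerA /res_mx -/Ax -/Ay.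
rewrite -scalemxAl -scalemxAr !scalerA.
congr (_ *: _); first by ring.
by rewrite !mulmxA comm.
Qed.

(** Orthogonality cancels g against its transpose, leaving x y times a product of adjugates; each
    adjugate is the corresponding [res_mx] plus a scalar. *)
Lemma res_mx_tr_mul (x y : K) : g *m g^T = 1%:M ->
  let px := \det (1%:M - x *: g) in let py := \det (1%:M - y *: g) in
  (1 - x * y) *: (res_mx g x *m (res_mx g y)^T) =
  (x * y) *: ((px * py)%:M + py *: res_mx g x + px *: (res_mx g y)^T).
Proof.
move=> gg px py.
set Ax := \adj (1%:M - x *: g); set Ay := \adj (1%:M - y *: g).
have comm z : g *m \adj (1%:M - z *: g) = \adj (1%:M - z *: g) *m g \/ z = 0.
  by have [->|z0] := eqVneq z 0; [right | left; apply: mulmx_adj_comm].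
have E : res_mx g x *m (res_mx g y)^T = (x * y) *: (Ax *m Ay^T).
  case: (comm x) => [cx | ->]; last by rewrite /res_mx !(scale0r,mul0mx,mul0r).
  case: (comm y) => [cy | ->]; last first.
    by rewrite /res_mx !(scale0r,trmx0,mulmx0,mulr0).
  rewrite /res_mx cx cy [X in _ *m X]linearZ /= trmx_mul -scalemxAl -scalemxAr scalerA.
  by congr (_ *: _); rewrite -mulmxA (mulmxA g) gg mul1mx.
rewrite scalerBl scale1r {1}E -scalerBr; congr (_ *: _).
apply/eqP; rewrite subr_eq; apply/eqP.
have Fx : Ax = res_mx g x + px%:M by rewrite res_mxE subrK.
have Fy : Ay = res_mx g y + py%:M by rewrite res_mxE subrK.
rewrite Fx Fy linearD /= tr_scalar_mx mulmxDl !mulmxDr mul_mx_scalar.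
rewrite !mul_scalar_mx scale_scalar_mx.
set a := _ *m _; set b := _ *: _; set c := _ *: _^T.
rewrite [RHS]addrC -[LHS]addrA; congr (_ + _).
by rewrite [in LHS]addrA [in LHS]addrC addrA.
Qed.

Lemma sum_beta_beta (M N : 'M[K]_n) :
  \sum_a \sum_b (M b a - M a b) * (N b a - N a b) =
  (\tr (M *m N^T) - \tr (M *m N)) *+ 2.
Proof.
have -> : \tr (M *m N^T) - \tr (M *m N) =
    \sum_a \sum_b (M a b * N a b - M a b * N b a).
  rewrite -sumrB; apply: eq_bigr => a _; rewrite !mxE -sumrB.
  by apply: eq_bigr => b _; rewrite !mxE.
rewrite mulr2n [X in _ + X]exchange_big -big_split; apply: eq_bigr => a _ /=.
by rewrite -big_split; apply: eq_bigr => b _ /=; ring.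
Qed.
End Resolvent.

(** * Alternants of antipalindromic polynomials *)

Section AlternantExpansion.
Variables (K : comNzRingType) (k : nat).

Lemma det_scale_col (A : 'M[K]_k) (c : 'I_k -> K) :
  \det (\matrix_(i, j) (c j * A i j)) = (\prod_j c j) * \det A.
Proof.
have -> : \matrix_(i, j) (c j * A i j) = A *m diag_mx (\row_j c j).
  apply/matrixP => i j; rewrite !mxE (bigD1 j) //= !mxE eqxx mulr1n big1.
    by rewrite addr0 mulrC.
  by move=> l /negPf lj; rewrite !mxE lj mulr0n mulr0.
by rewrite det_mulmx det_diag mulrC; congr (_ * _); apply: eq_bigr => j _; rewrite mxE.
Qed.

(** Column j involves [x j] alone, so expanding every column gives one determinant of coefficients
    per monomial. [F] may depend on the column, to allow for an operator acting on a single one. *)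
Lemma det_horner_col M (F : 'I_k -> 'I_k -> {poly K}) (x : 'I_k -> K) :
  (forall i j, size (F i j) <= M)%N ->
  \det (\matrix_(i, j) (F i j).[x j]) =
  \sum_(a : {ffun 'I_k -> 'I_M})
    (\prod_j x j ^+ a j) * \det (\matrix_(i, j) (F i j)`_(a j)).
Proof.
move=> sF; rewrite -det_tr [X in X = _]/determinant.
transitivity (\sum_s \sum_(a : {ffun 'I_k -> 'I_M}) (-1) ^+ odd_perm s *
    \prod_j ((F (s j) j)`_(a j) * x j ^+ a j)).
  apply: eq_bigr => s _; rewrite -big_distrr; congr (_ * _) => /=.
  rewrite -(bigA_distr_bigA (fun j (l : 'I_M) => (F (s j) j)`_l * x j ^+ l)).
  apply: eq_bigr => j _; rewrite !mxE.
  by rewrite (horner_coef_wide _ (sF _ _)).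
rewrite exchange_big /=; apply: eq_bigr => a _.
rewrite -det_tr [X in _ * X]/determinant big_distrr; apply: eq_bigr => s _ /=.
rewrite big_split /= [RHS]mulrCA; congr (_ * _).
by rewrite mulrC; congr (_ * _); apply: eq_bigr => j _; rewrite !mxE.
Qed.

Definition replace_col (A : 'M[K]_k) (j0 : 'I_k) (v : 'I_k -> K) : 'M[K]_k :=
  \matrix_(i, j) if j == j0 then v i else A i j.

Lemma det_replace_col (A : 'M[K]_k) j0 v :
  \det (replace_col A j0 v) = \sum_i v i * cofactor A i j0.
Proof.
rewrite (expand_det_col _ j0); apply: eq_bigr => i _; rewrite mxE eqxx.
congr (_ * _); rewrite /cofactor; congr (_ * \det _); apply/matrixP => a b.
by rewrite !mxE eq_sym (negPf (neq_lift _ _)).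
Qed.

(* With theta = X d/dX, this is theta^2 - m theta. *)
Definition euler_op (m : nat) (f : {poly K}) : {poly K} :=
  'X ^+ 2 * f^`()^`() + (1 - m%:R) *: ('X * f^`()).

Lemma coef_euler_op m f a :
  (euler_op m f)`_a = a%:R * (a%:R - m%:R) * f`_a.
Proof.
rewrite coefD coefZ coefXnM coefXM.
case: a => [|[|a]] /=; rewrite ?coef_deriv ?mulr0 ?addr0 ?mul0r //.
  by rewrite add0r mulr1n mul1r.
by rewrite subn2 /= -mulrnA -!(mulr_natr f`_a.+2) natrM; ring.
Qed.

Lemma size_euler_op m f : (size (euler_op m f) <= size f)%N.
Proof. by apply/leq_sizeP => a fa; rewrite coef_euler_op nth_default ?mulr0. Qed.

(** Applying the operator to column [j0] is applying it to the alternant in the variable [x j0], and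
    monomials are its eigenvectors. *)
Lemma sum_det_euler_op m M (f : 'I_k -> {poly K}) (x : 'I_k -> K) :
  (forall i, size (f i) <= M)%N ->
  \sum_j0 \det (replace_col (\matrix_(i, j) (f i).[x j]) j0
    (fun i => (euler_op m (f i)).[x j0])) =
  \sum_(a : {ffun 'I_k -> 'I_M}) (\sum_j (a j)%:R * ((a j)%:R - m%:R)) *
    ((\prod_j x j ^+ a j) * \det (\matrix_(i, j) (f i)`_(a j))).
Proof.
move=> sf; pose F (j0 i j : 'I_k) := if j == j0 then euler_op m (f i) else f i.
have E j0 : \det (replace_col (\matrix_(i, j) (f i).[x j]) j0
    (fun i => (euler_op m (f i)).[x j0])) =
    \sum_(a : {ffun 'I_k -> 'I_M}) (a j0)%:R * ((a j0)%:R - m%:R) *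
      ((\prod_j x j ^+ a j) * \det (\matrix_(i, j) (f i)`_(a j))).
  transitivity (\det (\matrix_(i, j) (F j0 i j).[x j])).
    congr (\det _); apply/matrixP => i j; rewrite !mxE /F.
    by case: eqP => // ->.
  rewrite (det_horner_col (M := M)); last first.
    by move=> i j; rewrite /F; case: ifP => // _; apply: leq_trans (size_euler_op _ _) _.
  apply: eq_bigr => a _; rewrite [RHS]mulrCA; congr (_ * _).
  pose c j := if j == j0 then (a j)%:R * ((a j)%:R - m%:R) else 1 : K.
  transitivity (\det (\matrix_(i, j) (c j * (\matrix_(i, j) (f i)`_(a j)) i j))).
    congr (\det _); apply/matrixP => i j; rewrite !mxE /F /c.
    by case: ifP => _; rewrite ?coef_euler_op ?mul1r.
  rewrite det_scale_col; congr (_ * _); rewrite (bigD1 j0) //= /c eqxx big1 ?mulr1 //.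
  by move=> j /negPf ->.
rewrite (eq_bigr _ (fun j0 _ => E j0)) exchange_big /=; apply: eq_bigr => a _.
by rewrite big_distrl.
Qed.

Definition antipal (m : nat) (f : {poly K}) :=
  forall a, (a <= m)%N -> f`_(m - a) = - f`_a.

(** Antipalindromy makes the columns at exponents a and m - a opposite, so a complementary pair of
    exponents is as degenerate as a repeated one. *)
Lemma det_coef_eq0 m (f : 'I_k -> {poly K}) (a : 'I_k -> nat) i j :
  (forall i, antipal m (f i)) -> (forall j, a j <= m)%N -> i != j ->
  a i = a j \/ (a i + a j)%N = m ->
  \det (\matrix_(i, j) (f i)`_(a j)) = 0.
Proof.
move=> anti am ij; rewrite -det_tr => -[aij | aij].
  by apply: (determinant_alternate ij) => l; rewrite !mxE aij.
pose c l := if l == j then -1 else 1 : K.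
pose a' l := if l == j then a i else a l.
have -> : (\matrix_(i, j) (f i)`_(a j))^T =
    (\matrix_(l, i0) (c i0 * (\matrix_(l, i0) (f l)`_(a' i0)) l i0))^T.
  apply/matrixP => u v; rewrite !mxE /c /a'; case: eqP => [->|_]; rewrite ?mul1r //.
  by rewrite mulN1r -anti // (_ : a j = m - a i)%N // -aij addKn.
rewrite det_tr det_scale_col -det_tr (determinant_alternate ij) ?mulr0 // => l.
by rewrite !mxE /a' eqxx (negPf ij).
Qed.

(* Truncating each [f i] to its exponents a with a < k or m - a < k does not
   change the left-hand side, and turns the matrix of values into C T with C
   unitriangular and T the matrix on the right. *)
Lemma alternant_collapse m (f : 'I_k -> {poly K}) (x : 'I_k -> K) :
  (2 * k <= m.+1)%N -> (forall i, antipal m (f i)) ->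
  (forall i r : 'I_k, (i < r)%N -> (f i)`_(k - r.+1) = 0) ->
  (forall i : 'I_k, (f i)`_(k - i.+1) = 1) ->
  \sum_(a : {ffun 'I_k -> 'I_m.+1} | [forall j, minn (a j) (m - a j) < k]%N)
    (\prod_j x j ^+ a j) * \det (\matrix_(i, j) (f i)`_(a j)) =
  \det (\matrix_(i < k, j < k) (x j ^+ (k - i.+1) - x j ^+ (m - (k - i.+1)))).
Proof.
move=> km anti f0 f1.
pose low a := (minn a (m - a) < k)%N.
pose ft i := \poly_(a < m.+1) (if low a then (f i)`_a else 0).
pose C : 'M[K]_k := \matrix_(i, r) (f i)`_(k - r.+1).
set T := \matrix_(i, j) _.
have detC : \det C = 1.
  rewrite det_trig; last first.
    by apply/is_trig_mxP => i r ir; rewrite mxE f0.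
  by rewrite big1 // => i _; rewrite mxE f1.
have ftE i y : (ft i).[y] =
    \sum_(r < k) (f i)`_(k - r.+1) * (y ^+ (k - r.+1) - y ^+ (m - (k - r.+1))).
  pose G a := (if low a then (f i)`_a else 0) * y ^+ a.
  rewrite horner_poly -(big_mkord xpredT G).
  (* As 2 k <= m + 1, the low exponents form two disjoint ranges, a < k and a > m - k, exchanged by
     a -> m - a; the middle range has been truncated to 0. *)
  rewrite (@big_cat_nat _ _ _ k) /=; [| by [] | lia].
  rewrite (@big_cat_nat _ _ _ (m.+1 - k) k m.+1) /=; [| lia | lia].
  have -> : \sum_(k <= a < m.+1 - k) G a = 0.
    rewrite big_nat_cond big1 // => a; rewrite andbT => /andP[ka am].
    by rewrite /G /low (_ : (_ < _)%N = false) ?mul0r //; lia.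
  have -> : \sum_(0 <= a < k) G a =
      \sum_(r < k) (f i)`_(k - r.+1) * y ^+ (k - r.+1).
    rewrite big_nat_rev big_mkord; apply: eq_bigr => r _.
    by rewrite add0n /G /low (_ : (_ < _)%N = true) //; have := ltn_ord r; lia.
  have -> : \sum_(m.+1 - k <= a < m.+1) G a =
      \sum_(r < k) - ((f i)`_(k - r.+1) * y ^+ (m - (k - r.+1))).
    rewrite -{1}(add0n (m.+1 - k)%N) big_addn subKn; last by lia.
    rewrite big_mkord; apply: eq_bigr => r _; have rk := ltn_ord r.
    have -> : (r + (m.+1 - k) = m - (k - r.+1))%N by lia.
    rewrite /G /low (_ : (_ < _)%N = true); last by lia.
    by rewrite anti ?mulNr //; lia.
  rewrite add0r -big_split; apply: eq_bigr => r _ /=.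
  by rewrite mulrBr.
have <- : \det (\matrix_(i, j) (ft i).[x j]) = \det T.
  rewrite -[RHS]mul1r -detC -det_mulmx; congr (\det _).
  apply/matrixP => i j; rewrite !mxE ftE; apply: eq_bigr => r _.
  by rewrite !mxE.
rewrite (det_horner_col (M := m.+1)) => [|i j]; last exact: size_poly.
rewrite big_mkcond; apply: eq_bigr => a _; case: ifPn => [/forallP al | ].
  congr (_ * \det _); apply/matrixP => i j; rewrite !mxE coef_poly ltn_ord.
  by rewrite /low al.
rewrite negb_forall => /existsP[j aj].
rewrite [X in _ = _ * X](expand_det_col _ j) [X in _ * X]big1 ?mulr0 // => i _.
by rewrite mxE coef_poly /low (negPf aj) if_same mul0r.
Qed.

End AlternantExpansion.

(** * Extremality of the eigenvalue, and interpolation on a grid *)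

Lemma sum_initial_minimal (M k : nat) (phi : nat -> nat) (b : 'I_k -> nat) :
  (forall i j, (i < j <= M)%N -> (phi i < phi j)%N) ->
  injective b -> (forall j, b j <= M)%N -> (k <= M.+1)%N ->
  (\sum_j phi (b j) <= \sum_(i < k) phi i)%N -> forall j, (b j < k)%N.
Proof.
move=> mono binj bM kM le_sum j.
have [kM1 | kM1] := ltnP M k; first exact: leq_ltn_trans (bM j) kM1.
pose B := [set (inord (b j) : 'I_M.+1) | j : 'I_k]%SET.
pose I := [set i : 'I_M.+1 | (i < k)%N]%SET.
have bI : injective (fun j => inord (b j) : 'I_M.+1).
  move=> u v /(congr1 val); rewrite /= !inordK ?ltnS ?bM //; exact: binj.
have cB : #|B| = k by rewrite card_imset // card_ord.
have I_sum (F : nat -> nat) : (\sum_(i in I) F i = \sum_(i < k) F i)%N.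
  rewrite -(big_mkord xpredT F) (big_nat_widen 0 k M.+1) //.
  by rewrite big_mkord; apply: eq_bigl => i; rewrite inE.
have cI : #|I| = k by rewrite -sum1_card (I_sum (fun=> 1%N)) sum1_card card_ord.
have B_sum : (\sum_(i in B) phi i = \sum_j phi (b j))%N.
  rewrite big_imset /=; last by move=> u v _ _; apply: bI.
  by apply: eq_bigr => u _; rewrite inordK // ltnS bM.
(* Exchange argument: the values outside the initial segment are as many as the missing ones, and
   each costs at least [phi k] against at most [phi k.-1]. *)
have cD : #|B :\: I| = #|I :\: B|.
  by rewrite !cardsD cB cI finset.setIC.
have kpos : (0 < k)%N := leq_ltn_trans (leq0n _) (ltn_ord j).
have lo : (#|B :\: I| * phi k <= \sum_(i in B :\: I) phi i)%N.
  rewrite -sum_nat_const; apply: leq_sum => i; rewrite !inE -leqNgt => /andP[ki _].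
  move: ki; rewrite leq_eqVlt => /orP[/eqP <- // | ki].
  by apply/ltnW/mono; rewrite ki -ltnS ltn_ord.
have hi : (\sum_(i in I :\: B) phi i <= #|I :\: B| * phi k.-1)%N.
  rewrite -sum_nat_const; apply: leq_sum => i; rewrite !inE => /andP[_ ik].
  have : (i <= k.-1)%N by rewrite -ltnS prednK.
  rewrite leq_eqVlt => /orP[/eqP <- // | ik'].
  by apply/ltnW/mono; rewrite ik' (leq_trans (leq_pred _)).
have phik : (phi k.-1 < phi k)%N by apply: mono; rewrite prednK // leqnn.
have : (\sum_(i in B) phi i <= \sum_(i in I) phi i)%N by rewrite B_sum I_sum.
rewrite (finset.big_setID I) [leqRHS](finset.big_setID B) /= finset.setIC leq_add2l => le2.
have : (#|B :\: I| * phi k <= #|B :\: I| * phi k.-1)%N.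
  by rewrite {2}cD (leq_trans lo) // (leq_trans le2).
rewrite leq_mul2l leqNgt phik orbF cards_eq0 finset.setD_eq0.
move=> /fintype.subsetP/(_ (inord (b j))).
by rewrite inE inordK ?ltnS ?bM // => -> //; apply: imset_f.
Qed.

(** [phi i = i (m - i)] is minus the eigenvalue, invariant under i -> m - i and strictly increasing
    on 0..M. The conditions on [a] say that the folded exponents are distinct, so
    [sum_initial_minimal] applies to them. *)
Lemma eigenvalue_low (K : numDomainType) (k M : nat) (a : 'I_k -> nat)
    (m := (2 * M).+1) :
  (k <= M.+1)%N -> (forall j, a j <= m)%N -> injective a ->
  (forall i j, i != j -> (a i + a j)%N != m) ->
  \sum_j (a j)%:R * ((a j)%:R - m%:R) = \sum_(i < k) i%:R * (i%:R - m%:R) :> K ->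
  forall j, (minn (a j) (m - a j) < k)%N.
Proof.
move=> kM am ainj asum E.
pose phi i := (i * (m - i))%N.
have conv (c : nat) : (c <= m)%N -> c%:R * (c%:R - m%:R) = - (phi c)%:R :> K.
  by move=> cm; rewrite /phi natrM natrB // -mulrN opprB.
have {}E : (\sum_j phi (a j) = \sum_(i < k) phi i)%N.
  apply/eqP; rewrite -(eqr_nat K) !natr_sum -eqr_opp -!sumrN; apply/eqP.
  transitivity (\sum_j (a j)%:R * ((a j)%:R - m%:R) : K).
    by apply: eq_bigr => j _; rewrite conv.
  rewrite E; apply: eq_bigr => i _; rewrite conv //.
  by apply: ltnW; apply: leq_trans (ltn_ord i) _; rewrite /m; lia.
apply: (@sum_initial_minimal M k phi (fun j => minn (a j) (m - a j))) => //.
- move=> i j /andP[ij jM]; rewrite /phi /m; nia.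
- move=> i j; have := am i; have := am j; have [-> //|ij] := eqVneq i j.
  have : a i != a j by apply: contraNneq ij => /ainj ->.
  by have := asum i j ij; rewrite /m; lia.
- by move=> j; have := am j; rewrite /m; lia.
rewrite -E; apply: leq_sum => j _; have := am j; rewrite /phi /minn.
by case: ifP => // _ ajm; rewrite subKn // mulnC.
Qed.

(** Inverting one Vandermonde matrix per variable recovers each coefficient from the values. The
    nodes may depend on the variable, which lets a grid avoid the diagonals. *)
Lemma coef_eq0_grid (K : fieldType) (k M : nat) (t : 'I_k -> 'I_M -> K)
    (c : {ffun 'I_k -> 'I_M} -> K) :
  (forall j, injective (t j)) ->
  (forall r : {ffun 'I_k -> 'I_M},
     \sum_(a : {ffun 'I_k -> 'I_M}) c a * \prod_j t j (r j) ^+ a j = 0) ->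
  forall a, c a = 0.
Proof.
move=> tinj czero b.
pose V j : 'M[K]_M := Vandermonde M (\row_r t j r).
have Vu j : V j \in unitmx.
  rewrite unitmxE unitfE det_Vandermonde; apply/prodf_neq0 => u _.
  apply/prodf_neq0 => v uv; rewrite !mxE subr_eq0.
  by apply: contraTneq uv => /tinj ->; rewrite ltnn.
have VK j (u v : 'I_M) : \sum_r t j r ^+ u * invmx (V j) r v = (u == v)%:R.
  have := mulmxV (Vu j) => /matrixP/(_ u v); rewrite !mxE => <-.
  by apply: eq_bigr => r _; rewrite !mxE.
transitivity (\sum_(a : {ffun 'I_k -> 'I_M}) c a * \prod_j (a j == b j)%:R).
  rewrite (bigD1 b) //= [X in _ * X]big1 ?mulr1; last first.
    by move=> j _; rewrite eqxx.
  rewrite big1 ?addr0 // => a ab; have [j abj] : exists j, a j != b j.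
    apply/existsP; apply: contraR ab => /existsPn H.
    by apply/eqP/ffunP => j; apply/eqP; move: (H j); rewrite negbK.
  by rewrite (bigD1 j) //= (negPf abj) mul0r mulr0.
transitivity (\sum_(r : {ffun 'I_k -> 'I_M}) (\prod_j invmx (V j) (r j) (b j)) *
    \sum_(a : {ffun 'I_k -> 'I_M}) c a * \prod_j t j (r j) ^+ a j); last first.
  by rewrite big1 // => r _; rewrite czero mulr0.
under [RHS]eq_bigr => r _ do rewrite big_distrr.
rewrite exchange_big; apply: eq_bigr => a _ /=.
rewrite (eq_bigr _ (fun j _ => esym (VK j (a j) (b j)))).
rewrite (bigA_distr_bigA (fun j r => t j r ^+ a j * invmx (V j) r (b j))).
rewrite big_distrr; apply: eq_bigr => r _ /=.
by rewrite big_split /= [RHS]mulrCA; congr (_ * _); rewrite mulrC.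
Qed.

(** * The radial Laplacian *)

Section PalindromicBasis.
Variables (K : comNzRingType) (k : nat).

Definition pal_mon (e i : nat) : {poly K} := 'X^e * (1 + 'X^2) ^+ i.

(* 'X^(k - 1) ('X + 'X^-1)^i *)
Definition pal_basis (i : 'I_k) : {poly K} := pal_mon (k - i.+1) i.

Lemma theta_pal_mon e i : 'X * (pal_mon e i)^`() =
  e%:R * pal_mon e i + (2 * i)%:R * pal_mon (e + 2) i.-1.
Proof.
rewrite /pal_mon derivM derivXn deriv_exp derivD derivXn derivC add0r /= expr1.
have e1 : 'X * ('X^(e.-1) *+ e) = e%:R * 'X^e :> {poly K}.
  by case: e => [|e]; rewrite ?mulr0n ?mulr0 ?mul0r //= mulrnAr -exprS mulr_natl.
rewrite mulrDr mulrA e1 exprD natrM -(mulr_natr ('X *+ 2 * _) i).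
move: ('X^e) ((1 + 'X^2) ^+ i) ((1 + 'X^2) ^+ i.-1) => A B C; ring.
Qed.

(** With u = X + X^-1 and theta = X d/dX, theta^2 sends u^i to i^2 u^i - 4 i (i - 1) u^(i - 2),
    because (X - X^-1)^2 = u^2 - 4. The factor X^(e + i) shifts theta by e + i. *)
Lemma theta2_pal_mon e i : 'X * ('X * (pal_mon e i)^`())^`() =
  2%:R * (e + i)%:R * ('X * (pal_mon e i)^`())
  + (i%:R ^+ 2 - (e + i)%:R ^+ 2) * pal_mon e i
  - (4 * (i * i.-1))%:R * pal_mon (e + 2) i.-2.
Proof.
have thetaD (p q : {poly K}) : 'X * (p + q)^`() = 'X * p^`() + 'X * q^`().
  by rewrite derivD mulrDr.
have thetaMn n (p : {poly K}) : 'X * (n%:R * p)^`() = n%:R * ('X * p^`()).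
  by rewrite !mulr_natl derivMn mulrnAr.
rewrite theta_pal_mon thetaD !thetaMn !theta_pal_mon /pal_mon.
rewrite !(exprD _ _ 2); move: ('X^e) => A.
case: i => [|[|i]] /=; rewrite ?expr0 ?expr1 ?(exprS _ i.+1) ?(exprS _ i).
- ring.
- ring.
move: ((1 + 'X^2) ^+ i) => B; rewrite !natrM; ring.
Qed.

Lemma size_pal_basis i : (size (pal_basis i) <= (2 * (k - 1)).+1)%N.
Proof.
have ik := ltn_ord i; rewrite /pal_basis /pal_mon.
apply: (leq_trans (size_polyMleq _ _)); rewrite size_polyXn /=.
have s2 : (size (1 + 'X^2 : {poly K})%R <= 3)%N.
  by rewrite (leq_trans (size_polyD _ _)) // size_poly1 size_polyXn.
have s3 : (size ((1 + 'X^2 : {poly K}) ^+ i)%R <= (2 * i).+1)%N.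
  apply: (leq_trans (size_poly_exp_leq _ _)); rewrite ltnS leq_mul2r.
  by rewrite -subn1 leq_subLR add1n s2 orbT.
by apply: (leq_trans (leq_add (leqnn _) s3)); lia.
Qed.

Lemma coef_pal_basis (i : 'I_k) r : (r <= k - i.+1)%N ->
  (pal_basis i)`_r = (r == k - i.+1)%N%:R.
Proof.
rewrite /pal_basis /pal_mon coefXnM leq_eqVlt => /orP[/eqP -> | rlt].
  rewrite ltnn subnn eqxx -horner_coef0 horner_exp !hornerE.
  by rewrite expr0n /= addr0 expr1n.
by rewrite rlt ltn_eqF.
Qed.

End PalindromicBasis.

Lemma prod_pairs (K : comNzRingType) (k : nat) (y : 'I_k -> K) :
  \prod_(i < k) \prod_(j < k | (i < j)%N) (y i * y j) = \prod_j y j ^+ (k - 1).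
Proof.
transitivity (\prod_(i < k)
    ((\prod_(j < k | (i < j)%N) y i) * (\prod_(j < k | (i < j)%N) y j))).
  by apply: eq_bigr => i _; rewrite big_split.
rewrite big_split /= [X in _ * X](exchange_big_dep xpredT) //= -big_split /=.
apply: eq_bigr => i _.
have -> : y i ^+ (k - 1) = \prod_(j < k | j != i) y i.
  by rewrite prodr_const cardC1 card_ord subn1.
rewrite [RHS](bigID (fun j : 'I_k => (i < j)%N)) /=; congr (_ * _);
  apply: eq_bigl => j; rewrite -val_eqE /=; lia.
Qed.

Section PalindromicDet.
Variables (K : fieldType) (k : nat).
Implicit Types x : 'I_k -> K.

Let u (y : K) := y + y^-1.

Definition pal_mx x : 'M[K]_k := \matrix_(i, j) (pal_basis K i).[x j].

Lemma horner_pal_basis (i : 'I_k) y : y != 0 ->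
  (pal_basis K i).[y] = y ^+ (k - 1) * u y ^+ i.
Proof.
move=> y0; have ik := ltn_ord i; rewrite /pal_basis /pal_mon hornerM horner_exp.
rewrite !hornerE (_ : 1 + y ^+ 2 = y * u y); last by rewrite /u mulrDr mulfV // addrC.
by rewrite exprMn mulrA -exprD; congr (_ ^+ _ * _); lia.
Qed.

(** Up to the factor x_j^(k - 1), column j is a Vandermonde column in u_j = x_j + 1/x_j, and u_j -
    u_i = (x_i - x_j) (1 - x_i x_j) / (x_i x_j). *)
Lemma det_pal_mx x : (forall j, x j != 0) -> \det (pal_mx x) =
  \prod_(i < k) \prod_(j < k | (i < j)%N) ((x i - x j) * (1 - x i * x j)).
Proof.
move=> x0; have -> : pal_mx x =
    \matrix_(i, j) (x j ^+ (k - 1) * Vandermonde k (\row_j u (x j)) i j).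
  by apply/matrixP => i j; rewrite !mxE horner_pal_basis.
rewrite det_scale_col det_Vandermonde.
have -> : \prod_(i < k) \prod_(j < k | (i < j)%N) ((x i - x j) * (1 - x i * x j)) =
    \prod_(i < k) \prod_(j < k | (i < j)%N) (x i * x j) *
    \prod_(i < k) \prod_(j < k | (i < j)%N)
      ((\row_j u (x j)) 0 j - (\row_j u (x j)) 0 i).
  rewrite -big_split; apply: eq_bigr => i _ /=; rewrite -big_split.
  apply: eq_bigr => j _ /=; rewrite !mxE /u; field.
  by rewrite !x0.
by congr (_ * _); rewrite prod_pairs.
Qed.

Variables (x : 'I_k -> K).
Hypothesis x0 : forall j, x j != 0.
Let V := pal_mx x.
Let W := \det V.

(** The determinant of [V] with column j replaced by [v] (see [det_replace_col]), as a linear form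
    in [v]. *)
Definition col_form (j : 'I_k) (v : 'I_k -> K) : K :=
  \sum_i v i * cofactor V i j.

Lemma col_form_basis (l j : 'I_k) :
  col_form j (fun i => (pal_basis K i).[x l]) = W *+ (l == j).
Proof.
have := congr1 (fun M : 'M[K]_k => M j l) (mul_adj_mx V).
rewrite !mxE eq_sym => <-; apply: eq_bigr => i _.
by rewrite !mxE mulrC.
Qed.

Lemma sum_col_form (i r : 'I_k) :
  \sum_j (pal_basis K r).[x j] * cofactor V i j = W *+ (r == i).
Proof.
have := congr1 (fun M : 'M[K]_k => M r i) (mul_mx_adj V).
by rewrite !mxE => <-; apply: eq_bigr => j _; rewrite !mxE.
Qed.

Hypothesis u_inj : forall i j, i != j -> u (x i) != u (x j).

(** The left side is x_j dW/dx_j, so this is the logarithmic derivative of the product formula for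
    W: each 1 comes from the factor x_j^(k - 1), each fraction from a difference of u's. *)
Lemma theta_col_form j :
  x j * col_form j (fun i => (pal_basis K i)^`().[x j]) =
  W * \sum_(l | l != j) (1 + (x j - (x j)^-1) / (u (x j) - u (x l))).
Proof.
have xj := x0 j.
pose A : {poly K} := \poly_(i < k) oapp (fun i' : 'I_k => cofactor V i' j) 0 (insub i).
have A_horner y : A.[y] = \sum_(i < k) cofactor V i j * y ^+ i.
  by rewrite horner_poly; apply: eq_bigr => i _; rewrite valK.
have dA_horner y : A^`().[y] = \sum_(i < k) cofactor V i j * (y ^+ i.-1 *+ i).
  rewrite /A poly_def raddf_sum horner_sum; apply: eq_bigr => i _ /=.
  by rewrite valK /= derivZ derivXn hornerZ hornerMn hornerXn.
have A_u l : x l ^+ (k - 1) * A.[u (x l)] = W *+ (l == j).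
  rewrite -col_form_basis A_horner big_distrr /=; apply: eq_bigr => i _.
  by rewrite horner_pal_basis // mulrCA mulrC.
pose Q : {poly K} := \prod_(l | l != j) ('X - (u (x l))%:P).
have Qj0 : Q.[u (x j)] != 0.
  rewrite horner_prod; apply/prodf_neq0 => l lj.
  by rewrite !hornerE subr_eq0 eq_sym u_inj.
(* Lagrange interpolation: both sides have degree below k and agree at the k distinct nodes
   [u (x l)]. *)
have AQ : Q.[u (x j)] *: A = A.[u (x j)] *: Q.
  apply/eqP; rewrite -subr_eq0; apply/eqP.
  apply: (@roots_geq_poly_eq0 _ _ [seq u (x l) | l <- enum 'I_k]).
  - apply/allP => _ /mapP[l _ ->]; rewrite /root hornerD hornerN !hornerZ.
    have [-> | lj] := eqVneq l j; first by rewrite mulrC subrr.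
    have := A_u l; rewrite (negPf lj) mulr0n => /eqP.
    rewrite mulf_eq0 expf_eq0 (negPf (x0 l)) andbF /= => /eqP ->.
    rewrite (_ : Q.[u (x l)] = 0) ?mulr0 ?subrr //.
    by rewrite /Q horner_prod (bigD1 l) //= !hornerE subrr mul0r.
  - rewrite map_inj_in_uniq ?enum_uniq // => a b _ _ uab.
    by apply/eqP/idPn => /u_inj; rewrite uab eqxx.
  rewrite size_map size_enum_ord (leq_trans (size_polyD _ _)) // size_polyN.
  rewrite geq_max !(leq_trans (size_scale_leq _ _)) ?size_poly //.
  rewrite (leq_trans (size_prod_leq _ _)) // (eq_bigr (fun=> 2)); last first.
    by move=> l _; rewrite size_XsubC.
  by rewrite sum_nat_const cardC1 card_ord; have := ltn_ord j; lia.
have dQ : Q^`().[u (x j)] = Q.[u (x j)] * \sum_(l | l != j) (u (x j) - u (x l))^-1.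
  rewrite /Q deriv_prod ?index_enum_uniq // horner_sum big_distrr /=.
  apply: eq_bigr => l lj; rewrite derivXsubC mul1r !horner_prod.
  rewrite [X in _ = X * _](bigD1 l) //= !hornerE mulrC mulrA mulVf ?mul1r //.
  by rewrite subr_eq0 u_inj // eq_sym.
have dA : x j ^+ (k - 1) * A^`().[u (x j)] =
    W * \sum_(l | l != j) (u (x j) - u (x l))^-1.
  have := congr1 (fun p => p^`().[u (x j)]) AQ; rewrite !derivZ !hornerZ dQ.
  rewrite mulrCA => /(mulfI Qj0) ->; rewrite mulrA A_u eqxx.
  by [].
have theta_w (i : 'I_k) : x j * (pal_basis K i)^`().[x j] = x j ^+ (k - 1) *
   ((k - 1)%:R * u (x j) ^+ i + (x j - (x j)^-1) * (u (x j) ^+ i.-1 *+ i)).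
  have ik := ltn_ord i.
  have := congr1 (fun p => p.[x j]) (theta_pal_mon K (k - i.+1) i).
  rewrite -/(pal_basis K i) hornerM hornerX => ->.
  rewrite hornerD (hornerM _ (pal_basis K i)) (hornerM _ (pal_mon _ _ _)).
  rewrite -!polyC_natr !hornerC horner_pal_basis //.
  case: i ik => [[|i] ik'] ik.
    rewrite /= !muln0 !mul0r mulr0n mulr0 !addr0 expr0 mulr1 mulrC.
    by rewrite mulr1.
  rewrite /= /pal_mon hornerM horner_exp !hornerE.
  rewrite (_ : 1 + x j ^+ 2 = x j * u (x j)); last by rewrite /u mulrDr mulfV // addrC.
  have E1 : x j ^+ (k - i.+2 + 2) * x j ^+ i = x j * x j ^+ (k - 1).
    by rewrite -exprD -exprS; congr (_ ^+ _); lia.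
  have E2 : (k - i.+2)%:R = (k - 1)%:R - i.+1%:R :> K.
    by rewrite -natrB; [congr (_%:R); lia | lia].
  rewrite exprMn E2 exprS natrM; set X := x j ^+ (k - 1); set U := u (x j) ^+ i.
  rewrite /=.
  transitivity (((k - 1)%:R - i.+1%:R) * X * (u (x j) * U) +
      2 * i.+1%:R * (x j ^+ (k - i.+2 + 2) * x j ^+ i) * U); first by ring.
  by rewrite E1 -/X -mulr_natr /u; field.
rewrite /col_form big_distrr /=.
under eq_bigr => i _ do rewrite mulrA theta_w.
transitivity (x j ^+ (k - 1) * ((k - 1)%:R * A.[u (x j)] +
    (x j - (x j)^-1) * A^`().[u (x j)])).
  rewrite A_horner dA_horner !big_distrr -big_split big_distrr /=.
  by apply: eq_bigr => i _; ring.
rewrite mulrDr mulrCA A_u eqxx mulr1n mulrCA dA big_split /= mulrDr.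
rewrite sumr_const cardC1 card_ord subn1 mulrC; congr (_ + _).
by rewrite mulrCA; congr (_ * _); rewrite big_distrr.
Qed.

(** The operator is triangular on the basis: it maps w_i to a multiple of itself plus a multiple of
    w_(i - 2). Summing over columns against cofactors keeps the diagonal only. *)
Lemma sum_theta2_col_form :
  \sum_j col_form j (fun i =>
     (euler_op (2 * (k - 1)) (pal_basis K i)).[x j]) =
  W * \sum_(i < k) (i%:R ^+ 2 - (k - 1)%:R ^+ 2).
Proof.
rewrite exchange_big /= big_distrr /=; apply: eq_bigr => i _.
have E : euler_op (2 * (k - 1)) (pal_basis K i) =
    (i%:R ^+ 2 - (k - 1)%:R ^+ 2) * pal_basis K i
    - (4 * (i * i.-1))%:R * pal_mon K (k - i.+1 + 2) i.-2.
  have := theta2_pal_mon K (k - i.+1) i.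
  have -> : (k - i.+1 + i = k - 1)%N by have := ltn_ord i; lia.
  rewrite /euler_op -/(pal_basis K i); move: (pal_basis K i) => w.
  rewrite derivM derivX mul1r mulrDr mulrA -expr2 => E.
  have {}E : 'X ^+ 2 * w^`()^`() = 2%:R * (k - 1)%:R * ('X * w^`()) +
    (i%:R ^+ 2 - (k - 1)%:R ^+ 2) * w -
    (4 * (i * i.-1))%:R * pal_mon K (k - i.+1 + 2) i.-2 - 'X * w^`().
    by rewrite -E [RHS]addrC addrA addNr add0r.
  by rewrite E -mul_polyC polyCB polyC1 polyC_natr natrM; ring.
rewrite E.
transitivity (\sum_j ((i%:R ^+ 2 - (k - 1)%:R ^+ 2) *
    ((pal_basis K i).[x j] * cofactor V i j) -
   (4 * (i * i.-1))%:R * ((pal_mon K (k - i.+1 + 2) i.-2).[x j] * cofactor V i j))).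
  apply: eq_bigr => j _; rewrite hornerD hornerN !hornerM.
  rewrite -!polyC_natr -!polyC_exp -polyCB !hornerC; ring.
rewrite sumrB -!big_distrr /= sum_col_form eqxx mulr1n mulrC.
case: i {E} => [[|[|i]] ik] /=; rewrite ?muln0 ?mul0r ?subr0 //.
have i2k : (i < k)%N by lia.
have := sum_col_form (Ordinal ik) (Ordinal i2k).
rewrite /pal_basis /= (_ : (k - i.+3 + 2)%N = (k - i.+1)%N) => [->|]; last by lia.
by rewrite -val_eqE /= (_ : (i == i.+2) = false) ?mulr0 ?subr0 //; lia.
Qed.

End PalindromicDet.

Lemma sum_antisym_eq0 (K : numDomainType) (k : nat) (H : 'I_k -> 'I_k -> K) :
  (forall i j, i != j -> H i j = - H j i) ->
  \sum_i \sum_(j | j != i) H i j = 0.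
Proof.
move=> anti; set S := LHS; have E : S = - S.
  rewrite {1}/S (exchange_big_dep xpredT) //= /S -sumrN; apply: eq_bigr => i _.
  rewrite -sumrN; apply: eq_big => [j | j ij]; first by rewrite eq_sym.
  by rewrite anti // eq_sym.
have : S *+ 2 = 0 by rewrite mulr2n {2}E subrr.
by move/eqP; rewrite mulrn_eq0 /= => /eqP.
Qed.

(** The eigenvalue without p and the final one, with m = n + 2 (k - 1), differ by a constant that
    compensates the terms n p(y) p(z) of [laplace_cross] over the k (k - 1) ordered pairs. It is
    doubled to avoid halves. *)
Lemma double_eigenvalue_gap (K : comNzRingType) (k n : nat) :
  2 * (\sum_(i < k) (i%:R ^+ 2 - (k - 1)%:R ^+ 2)
     - \sum_(i < k) i%:R * (i%:R - (n + 2 * (k - 1))%:R)) =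
  n%:R * k%:R * (k - 1)%:R :> K.
Proof.
have gauss q : 2 * \sum_(i < q) i%:R = q%:R * (q%:R - 1) :> K.
  elim: q => [|q IH]; first by rewrite big_ord0 mulr0 mul0r.
  by rewrite big_ord_recr mulrDr IH /=; ring.
rewrite -sumrB (eq_bigr (fun i : 'I_k =>
  (n + 2 * (k - 1))%:R * i%:R - (k - 1)%:R ^+ 2)); last by move=> i _; ring.
rewrite sumrB -big_distrr /= sumr_const card_ord mulrBr mulrCA gauss.
case: k => [|k]; first by rewrite mulr0n !(mulr0, mul0r) subr0.
by rewrite subn1 /= -mulr_natr; ring.
Qed.

(** * Conjugation of the radial Laplacian by W *)

Section EulerAlternant.
Variables (K : numFieldType) (k n : nat) (p : {poly K}) (x : 'I_k -> K).
Hypothesis x0 : forall j, x j != 0.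
Hypothesis x_inj : forall i j, i != j -> x i != x j.
Hypothesis x_inv : forall i j, i != j -> x i * x j != 1.

Let m := (n + 2 * (k - 1))%N.
Let u (y : K) := y + y^-1.

Definition theta (y : K) := y * p^`().[y].

(* When p = det (1 - 'X g) with g orthogonal of size n, [radial_laplacian] is
   the Laplacian in g of \prod_j p.[x j], expressed through derivatives in x. *)
Definition laplace_diag (y : K) :=
  y ^+ 2 * p^`()^`().[y] - (n%:R - 1) * theta y.

Definition laplace_cross (y z : K) :=
  y * z / (1 - y * z) *
    (n%:R * p.[y] * p.[z] - theta y * p.[z] - p.[y] * theta z)
  + (z * theta y * p.[z] - y * p.[y] * theta z) / (y - z).

Definition radial_laplacian :=
  \sum_j laplace_diag (x j) * \prod_(l | l != j) p.[x l] +
  \sum_j \sum_(i | i != j) laplace_cross (x i) (x j) *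
    \prod_(l | (l != j) && (l != i)) p.[x l].

Let uB i j : u (x i) - u (x j) = (x i - x j) * (x i * x j - 1) / (x i * x j).
Proof. by rewrite /u; field; rewrite !x0. Qed.

Let u_inj i j : i != j -> u (x i) != u (x j).
Proof.
move=> ij; rewrite -subr_eq0 uB !mulf_neq0 ?invr_eq0 ?mulf_neq0 ?subr_eq0 //.
- exact: x_inj.
- exact: x_inv.
Qed.

(** This is x_i d/dx_i of log ((x_i - x_j) (1 - x_i x_j)). *)
Let kappa i j := x i / (x i - x j) - x i * x j / (1 - x i * x j).

Let kappaE i j : i != j ->
  1 + (x i - (x i)^-1) / (u (x i) - u (x j)) = kappa i j.
Proof.
move=> ij; have xi := x0 i; have xj := x0 j.
have d1 : x i - x j != 0 by rewrite subr_eq0 x_inj.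
have d2 : 1 - x i * x j != 0 by rewrite subr_eq0 eq_sym x_inv.
have d3 : x i * x j - 1 != 0 by rewrite subr_eq0 x_inv.
rewrite uB /kappa; field; rewrite ?xi ?xj ?d1 ?d2 ?d3 //.
Qed.

(** By the Leibniz rule the operator acts on w_i, on p, or once on each; the mixed terms carry the
    logarithmic derivative of W and must produce the cross terms of the Laplacian. *)
Lemma sum_euler_alternant :
  \sum_j0 \det (replace_col (\matrix_(i, j) (pal_basis K i * p).[x j]) j0
    (fun i => (euler_op m (pal_basis K i * p)).[x j0])) =
  \det (pal_mx x) * radial_laplacian +
  (\sum_(i < k) i%:R * (i%:R - m%:R)) * (\det (pal_mx x) * \prod_j p.[x j]).
Proof.
set W := \det (pal_mx x); set h := \prod_j p.[x j].
pose P j := \prod_(l | l != j) p.[x l].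
pose P2 j i := \prod_(l | (l != j) && (l != i)) p.[x l].
have hP j : h = p.[x j] * P j by rewrite /h (bigD1 j).
have PP i j : i != j -> P j = p.[x i] * P2 j i.
  by move=> ij; rewrite /P (bigD1 i).
have step1 j : \det (replace_col (\matrix_(i, j) (pal_basis K i * p).[x j]) j
    (fun i => (euler_op m (pal_basis K i * p)).[x j])) =
    P j * col_form x j (fun i => (euler_op m (pal_basis K i * p)).[x j]).
  pose c l := if l == j then 1 else p.[x l].
  rewrite /col_form -det_replace_col.
  have -> : P j = \prod_l c l.
    rewrite (bigD1 j) //= /c eqxx mul1r; apply: eq_bigr => l /negPf -> //.
  rewrite -det_scale_col; congr (\det _); apply/matrixP => a b; rewrite !mxE /c.
  by case: ifP => _; rewrite ?mul1r // hornerM mulrC.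
have step2 j : col_form x j (fun i => (euler_op m (pal_basis K i * p)).[x j]) =
    p.[x j] * col_form x j (fun i => (euler_op (2 * (k - 1)) (pal_basis K i)).[x j])
    + (2 * theta (x j) - n%:R * p.[x j]) *
      (x j * col_form x j (fun i => (pal_basis K i)^`().[x j]))
    + (laplace_diag (x j) - 2 * (k - 1)%:R * theta (x j)) * W.
  have -> : W = col_form x j (fun i => (pal_basis K i).[x j]).
    by rewrite col_form_basis eqxx.
  rewrite /col_form !big_distrr -!big_split; apply: eq_bigr => i _ /=.
  rewrite /euler_op /laplace_diag /theta !derivM derivD !derivM.
  rewrite !(hornerD, hornerM, hornerN, hornerZ, hornerXn, hornerX) /m natrD natrM.
  ring.
(* The mixed terms match the cross terms only after symmetrising: the summand changes sign when j
   and l are exchanged. *)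
have sumG : \sum_j \sum_(l | l != j)
   (n%:R * p.[x j] * p.[x l] +
    2 * ((2 * theta (x j) - n%:R * p.[x j]) * kappa j l - 2 * theta (x j)) * p.[x l]
    - 2 * laplace_cross (x l) (x j)) * P2 j l = 0.
  apply: sum_antisym_eq0 => i j ij.
  have -> : P2 j i = P2 i j by apply: eq_bigl => l; rewrite andbC.
  rewrite -[RHS]mulNr; congr (_ * _); apply/eqP; rewrite -subr_eq0 opprK; apply/eqP.
  have d1 : x i - x j != 0 by rewrite subr_eq0 x_inj.
  have d1' : x j - x i != 0 by rewrite subr_eq0 x_inj // eq_sym.
  have d2 : 1 - x i * x j != 0 by rewrite subr_eq0 eq_sym x_inv.
  have d2' : 1 - x j * x i != 0 by rewrite mulrC.
  rewrite /laplace_cross /kappa; move: (theta _) (theta _) (p.[_]) (p.[_]) => a b c d.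
  by field; rewrite ?d1 ?d1' ?d2 ?d2'.
rewrite (eq_bigr _ (fun j _ => step1 j)).
pose T j l := (2 * theta (x j) - n%:R * p.[x j]) * kappa j l - 2 * theta (x j).
set c := \sum_(i < k) i%:R * _.
pose c0 : K := \sum_(i < k) (i%:R ^+ 2 - (k - 1)%:R ^+ 2).
pose A := \sum_j laplace_diag (x j) * P j.
pose B := \sum_j \sum_(l | l != j) T j l * p.[x l] * P2 j l.
pose C := \sum_j \sum_(i | i != j) laplace_cross (x i) (x j) * P2 j i.
have -> : \sum_j P j * col_form x j (fun i => (euler_op m (pal_basis K i * p)).[x j]) =
    h * (W * c0) + W * A + W * B.
  rewrite /c0 -sum_theta2_col_form /A /B !big_distrr -!big_split.
  apply: eq_bigr => j _ /=; rewrite step2 theta_col_form //.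
  have -> : \sum_(l | l != j) T j l * p.[x l] * P2 j l =
     ((2 * theta (x j) - n%:R * p.[x j]) *
       \sum_(l | l != j) (1 + (x j - (x j)^-1) / (u (x j) - u (x l)))
       - 2 * (k - 1)%:R * theta (x j)) * P j.
    transitivity (\sum_(l | l != j) T j l * P j).
      by apply: eq_bigr => l lj; rewrite (PP l j) // mulrA.
    rewrite -big_distrl /=; congr (_ * _); rewrite /T sumrB -big_distrr /=.
    congr (_ * _ - _).
      by apply: eq_bigr => l lj; rewrite kappaE // eq_sym.
    by rewrite sumr_const cardC1 card_ord subn1 -[LHS]mulr_natr mulrAC.
  rewrite (hP j) -/W; ring.
have hE : \sum_j \sum_(l | l != j) n%:R * p.[x j] * p.[x l] * P2 j l =
    n%:R * k%:R * (k - 1)%:R * h.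
  transitivity (\sum_(j < k) \sum_(l | l != j) n%:R * h).
    apply: eq_bigr => j _; apply: eq_bigr => l lj.
    by rewrite (hP j) (PP l j) // !mulrA.
  rewrite (eq_bigr (fun=> (k - 1)%:R * (n%:R * h))); last first.
    by move=> j _; rewrite sumr_const cardC1 card_ord subn1 -[LHS]mulr_natl.
  by rewrite sumr_const card_ord -mulr_natl; ring.
have BC : n%:R * k%:R * (k - 1)%:R * h + 2 * B - 2 * C = 0.
  rewrite -hE /B /C !big_distrr -big_split -sumrB -[RHS]sumG.
  apply: eq_bigr => j _ /=; rewrite !big_distrr -big_split -sumrB /=.
  by apply: eq_bigr => l _; rewrite /T; ring.
have /eqP : 2 * (h * (W * c0) + W * A + W * B -
    (W * radial_laplacian + c * (W * h))) = 0.
  have -> : radial_laplacian = A + C by [].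
  rewrite -[RHS](mulr0 W) -[in RHS]BC -(double_eigenvalue_gap K k n) -/c0 -/m -/c.
  ring.
by rewrite mulf_eq0 pnatr_eq0 /= subr_eq0 => /eqP.
Qed.

End EulerAlternant.

(** Nodes start at 1, so functional equations relating y to 1/y can be used at them. *)
Lemma poly_eq_nat (K : numDomainType) (p q : {poly K}) :
  (forall l : nat, p.[l.+1%:R] = q.[l.+1%:R]) -> p = q.
Proof.
move=> E; apply/eqP; rewrite -subr_eq0; apply/eqP.
apply: (@roots_geq_poly_eq0 _ _ [seq i.+1%:R | i <- iota 0 (size (p - q))]).
- by apply/allP => _ /mapP[i _ ->]; rewrite /root hornerD hornerN E subrr.
- rewrite map_inj_uniq ?iota_uniq // => i j /eqP.
  by rewrite eqr_nat eqSS => /eqP.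
by rewrite size_map size_iota.
Qed.

Lemma coef2_prod (K : comNzRingType) (k : nat) (F : 'I_k -> {poly K}) :
  (\prod_j F j)`_2 *+ 2 =
  \sum_j (F j)`_2 *+ 2 * \prod_(l | l != j) (F l)`_0 +
  \sum_j \sum_(i | i != j) (F j)`_1 * (F i)`_1 *
    \prod_(l | (l != j) && (l != i)) (F l)`_0.
Proof.
have c2 (p : {poly K}) : p^`()^`().[0] = p`_2 *+ 2.
  by rewrite horner_coef0 !coef_deriv mulr1n.
have c1 (p : {poly K}) : p^`().[0] = p`_1.
  by rewrite horner_coef0 coef_deriv mulr1n.
rewrite -c2 deriv_prod ?index_enum_uniq // raddf_sum horner_sum -big_split.
apply: eq_bigr => j _ /=; rewrite derivM hornerD !hornerM c2 c1; congr (_ * _ + _).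
  by rewrite horner_prod; apply: eq_bigr => l _; rewrite horner_coef0.
rewrite deriv_prod ?index_enum_uniq // horner_sum big_distrr /=.
apply: eq_bigr => i _; rewrite hornerM c1 mulrA; congr (_ * _).
by rewrite horner_prod; apply: eq_bigr => l _; rewrite horner_coef0.
Qed.

(** * Haar integration *)

Section HaarIntegral.
Variables (R : realType) (n : nat) (mu : probability (borel_mx R n) R).
Hypothesis hmu : is_SO_haar mu.

Local Notation mat := 'M[R]_n.

Lemma cvg_sumr (T I : Type) (F : set_system T) {FF : Filter F} (r : seq I)
    (f : I -> T -> R) (l : I -> R) : (forall i, f i @ F --> l i) ->
  (fun x => \sum_(i <- r) f i x) @ F --> \sum_(i <- r) l i.
Proof.
move=> fl; elim: r => [|a r IH].
  by rewrite big_nil; under eq_fun do rewrite big_nil; apply: cvg_cst.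
by rewrite big_cons; under eq_fun do rewrite big_cons; apply: cvgD.
Qed.

Lemma mulmx_continuous (h : mat) : continuous (fun g : mat => h *m g).
Proof.
move=> M A /= [P MP sPA].
have cvg_coord i j : (fun N : mat => (h *m N) i j) @ M --> (h *m M) i j.
  rewrite mxE; under eq_fun do rewrite mxE.
  apply: (@cvg_sumr _ _ (nbhs M) _ _ (fun l (N : mat) => h i l * N l j)) => l.
  by apply: cvgM; [apply: cvg_cst | apply: coord_continuous].
have : nbhs M (fun N : mat => forall i j, P i j ((h *m N) i j)).
  refine (@filter_forall mat 'I_n (fun i N => forall j, P i j ((h *m N) i j))
    (nbhs M) (nbhs_filter M) _) => i.
  refine (@filter_forall mat 'I_n (fun j N => P i j ((h *m N) i j))
    (nbhs M) (nbhs_filter M) _) => j.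
  exact: (cvg_coord i j _ (MP i j)).
by apply: filterS => N /sPA.
Qed.

Lemma measurable_mulmx (h : mat) :
  measurable_fun setT ((fun g : mat => h *m g) : borel_mx R n -> borel_mx R n).
Proof.
apply: (@measurability _ _ (borel_mx R n) (borel_mx R n) setT _ (@open mat)) => // _ [A oA <-].
rewrite setTI; apply: sub_sigma_algebra.
exact: (open_comp (fun x _ => @mulmx_continuous h x)).
Qed.

(** Boundedness is asked on SO(n) only, where the matrix entries are bounded; with finite mass it
    gives integrability. *)
Definition bmeas (f : mat -> R) :=
  measurable_fun setT (f : borel_mx R n -> R) /\
  exists C, forall g, SO g -> `|f g| <= C.

Lemma bmeas_cst c : bmeas (fun=> c).
Proof. by split; [exact: measurable_cst | exists `|c|]. Qed.

Lemma bmeasD f g : bmeas f -> bmeas g -> bmeas (fun x => f x + g x).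
Proof.
move=> [mf [C hC]] [mg [D hD]]; split; first exact: measurable_funD.
by exists (C + D) => x Sx; rewrite (le_trans (ler_normD _ _)) // lerD ?hC ?hD.
Qed.

Lemma bmeasM f g : bmeas f -> bmeas g -> bmeas (fun x => f x * g x).
Proof.
move=> [mf [C hC]] [mg [D hD]]; split; first exact: measurable_funM.
by exists (C * D) => x Sx; rewrite normrM ler_pM ?hC ?hD.
Qed.

Lemma bmeasN f : bmeas f -> bmeas (fun x => - f x).
Proof.
move=> bf; have := bmeasM (bmeas_cst (-1)) bf.
by congr bmeas; apply/funext => x; rewrite mulN1r.
Qed.

Lemma bmeas_sum (I : Type) (r : seq I) (P : pred I) (F : I -> mat -> R) :
  (forall i, bmeas (F i)) -> bmeas (fun x => \sum_(i <- r | P i) F i x).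
Proof.
move=> bF; elim: r => [|a r IH].
  by under eq_fun do rewrite big_nil; apply: bmeas_cst.
under eq_fun do rewrite big_cons.
by case: (P a) => //; apply: bmeasD.
Qed.

Lemma bmeas_prod (I : Type) (r : seq I) (P : pred I) (F : I -> mat -> R) :
  (forall i, bmeas (F i)) -> bmeas (fun x => \prod_(i <- r | P i) F i x).
Proof.
move=> bF; elim: r => [|a r IH].
  by under eq_fun do rewrite big_nil; apply: bmeas_cst.
under eq_fun do rewrite big_cons.
by case: (P a) => //; apply: bmeasM.
Qed.

Lemma bmeas_det k (A : mat -> 'M[R]_k) :
  (forall i j, bmeas (fun g => A g i j)) -> bmeas (fun g => \det (A g)).
Proof.
move=> bA; apply: bmeas_sum => s; apply: bmeasM; first exact: bmeas_cst.
by apply: bmeas_prod => i; apply: bA.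
Qed.

Lemma measurable_coord i j :
  measurable_fun setT ((fun g : mat => g i j) : borel_mx R n -> R).
Proof.
apply: (measurability _ (RGenOInfty.measurableE R)) => // _ [_ [x ->] <-].
rewrite setTI; apply: sub_sigma_algebra.
apply: (open_comp (fun g _ => @coord_continuous R n n i j g)).
exact: interval_open.
Qed.

Lemma bmeas_coord i j : bmeas (fun g => g i j).
Proof.
split; first exact: measurable_coord.
exists 1 => g [gg _]; rewrite -(@ler_pXn2r _ 2) ?nnegrE // expr1n real_normK ?num_real //.
have E : \sum_l g i l * g^T l i = 1.
  by have := congr1 (fun M : mat => M i i) gg; rewrite !mxE eqxx.
rewrite -[leRHS]E (bigD1 j) //= !mxE -expr2 lerDl sumr_ge0 // => l _.
by rewrite mxE -expr2 sqr_ge0.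
Qed.

Lemma measurable_SO : measurable (@SO R n : set (borel_mx R n)).
Proof.
(* A sum of squares exhibits SO(n) as the zero set of a single measurable function. *)
pose F (g : mat) := (\det g - 1) ^+ 2 +
  \sum_i \sum_j ((g *m g^T) i j - (1%:M : mat) i j) ^+ 2.
have mF : bmeas F.
  apply: bmeasD.
    by apply: bmeasM; apply: bmeasD; try exact: bmeas_cst;
       apply: bmeas_det => i j; apply: bmeas_coord.
  apply: bmeas_sum => i; apply: bmeas_sum => j.
  have b : bmeas (fun g => (g *m g^T) i j - (1%:M : mat) i j).
    apply: bmeasD; last exact: bmeas_cst.
    under eq_fun do rewrite mxE; apply: bmeas_sum => l; apply: bmeasM.
      exact: bmeas_coord.
    by under eq_fun do rewrite mxE; apply: bmeas_coord.
  exact: bmeasM.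
have -> : @SO R n = F @^-1` [set 0].
  apply/seteqP; split => g /=.
    case=> gg dg; rewrite /F dg gg subrr expr0n add0r big1 // => i _.
    by rewrite big1 // => j _; rewrite subrr expr0n.
  have s0 : 0 <= \sum_i \sum_j ((g *m g^T) i j - (1%:M : mat) i j) ^+ 2.
    by apply: sumr_ge0 => i _; apply: sumr_ge0 => j _; apply: sqr_ge0.
  move=> /eqP; rewrite paddr_eq0 ?sqr_ge0 // sqrf_eq0 subr_eq0 => /andP[/eqP dg].
  rewrite psumr_eq0 => [/allP E|i _]; last by apply: sumr_ge0 => j _; apply: sqr_ge0.
  split=> //; apply/matrixP => i j.
  have := E i (mem_index_enum i); rewrite /= psumr_eq0 => [/allP E2|l _]; last exact: sqr_ge0.
  by have := E2 j (mem_index_enum j); rewrite /= sqrf_eq0 subr_eq0 => /eqP.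
rewrite -[X in measurable X]setTI; apply: mF.1 => //.
Qed.

Definition haar_int (f : mat -> R) : R := \int[mu]_(g in @SO R n) f g.

Lemma bmeas_integrable f : bmeas f ->
  mu.-integrable (@SO R n) (EFin \o (f : borel_mx R n -> R)).
Proof.
move=> [mf [C hC]]; apply: measurable_bounded_integrable.
- exact: measurable_SO.
- exact: (le_lt_trans (probability_le1 mu measurable_SO) (ltry _)).
- exact: measurable_funTS.
exists C; split; first exact: num_real.
by move=> x Cx g Sg; rewrite /= (le_trans (hC g Sg)) // ltW.
Qed.

Lemma haar_int_cst c : haar_int (fun=> c) = c.
Proof.
have E : mu (@SO R n) = 1%:E := hmu.1.
transitivity (c * fine (mu (@SO R n))); last by rewrite E mulr1.
exact: (Rintegral_cst mu measurable_SO c).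
Qed.

Lemma haar_intD f g : bmeas f -> bmeas g ->
  haar_int (fun x => f x + g x) = haar_int f + haar_int g.
Proof.
move=> bf bg; apply: RintegralD; [exact: measurable_SO| |]; exact: bmeas_integrable.
Qed.

Lemma haar_intZ c f : bmeas f -> haar_int (fun x => c * f x) = c * haar_int f.
Proof.
by move=> bf; apply: RintegralZl; [exact: measurable_SO | exact: bmeas_integrable].
Qed.

Lemma haar_int_sum (I : Type) (r : seq I) (P : pred I) (F : I -> mat -> R) :
  (forall i, bmeas (F i)) ->
  haar_int (fun x => \sum_(i <- r | P i) F i x) =
  \sum_(i <- r | P i) haar_int (F i).
Proof.
move=> bF; elim: r => [|a r IH].
  by under eq_fun do rewrite big_nil; rewrite haar_int_cst big_nil.
under eq_fun do rewrite big_cons; rewrite big_cons.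
by case: (P a) => //; rewrite haar_intD ?IH //; apply: bmeas_sum.
Qed.

Lemma eq_haar_int f g : (forall x, SO x -> f x = g x) -> haar_int f = haar_int g.
Proof. by move=> fg; apply: eq_Rintegral => x; rewrite inE => /fg. Qed.

Lemma SO_mul (h g : mat) : SO h -> SO g -> SO (h *m g).
Proof.
move=> [hh dh] [gg dg]; split; last by rewrite det_mulmx dh dg mulr1.
by rewrite trmx_mul mulmxA -(mulmxA h) gg mulmx1.
Qed.

Lemma SO_tr (h : mat) : SO h -> SO h^T.
Proof. by move=> [hh dh]; split; rewrite ?det_tr // trmxK; apply: mulmx1C. Qed.

(** The preimage of a set under left multiplication by h is its image under the transpose of h,
    again in SO(n), so invariance identifies the pushforward of [mu] with [mu]. *)
Lemma haar_int_mul (h : mat) f : SO h -> bmeas f ->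
  haar_int (fun g => f (h *m g)) = haar_int f.
Proof.
move=> Sh bf; have [mf _] := bf; rewrite /haar_int /Rintegral; congr fine.
have Sht := SO_tr Sh.
have hht : h *m h^T = 1%:M by case: Sh.
have hth : h^T *m h = 1%:M by case: Sht; rewrite trmxK.
pose phi : borel_mx R n -> borel_mx R n := fun g : mat => h *m g.
have preE (A : set mat) : phi @^-1` A = [set h^T *m g | g in A].
  apply/seteqP; split => g /=.
    by move=> Ag; exists (h *m g) => //; rewrite mulmxA hth mul1mx.
  by case=> g' Ag' <-; rewrite /phi mulmxA hht mul1mx.
have SOE : phi @^-1` (@SO R n) = @SO R n.
  apply/seteqP; split => g /=; last exact: SO_mul.
  by move=> Shg; rewrite -[g]mul1mx -hth -mulmxA; apply: SO_mul.
have mphi : measurable_fun setT phi := measurable_mulmx h.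
rewrite -[in LHS]SOE.
rewrite -(@integral_pushforward _ _ _ _ _ phi mphi mu _ (EFin \o (f : borel_mx R n -> R))).
- apply: eq_measure_integral => //= A mA _; rewrite /pushforward preE.
  exact: hmu.2.
- exact/measurable_EFinP.
- rewrite SOE; apply: (@bmeas_integrable (fun g => f (h *m g))).
  split; first exact: (measurableT_comp mf (measurable_mulmx h)).
  by case: bf => _ [C hC]; exists C => g Sg; apply: hC; apply: SO_mul.
- exact: measurable_SO.
Qed.

Lemma haar_int_sumZ (I : finType) (c : I -> R) (F : I -> mat -> R) :
  (forall i, bmeas (F i)) ->
  haar_int (fun x => \sum_i c i * F i x) = \sum_i c i * haar_int (F i).
Proof.
move=> bF; rewrite haar_int_sum => [|i].
  by apply: eq_bigr => i _; rewrite haar_intZ.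
by apply: bmeasM => //; apply: bmeas_cst.
Qed.

Definition bpoly (F : mat -> {poly R}) := forall i, bmeas (fun g => (F g)`_i).

Lemma bpolyC f : bmeas f -> bpoly (fun g => (f g)%:P).
Proof.
move=> bf [|i]; under eq_fun do rewrite coefC /=; first by [].
exact: bmeas_cst.
Qed.

Lemma bpoly_cst p : bpoly (fun=> p).
Proof. by move=> i; apply: bmeas_cst. Qed.

Lemma bpolyD F G : bpoly F -> bpoly G -> bpoly (fun g => F g + G g).
Proof. by move=> bF bG i; under eq_fun do rewrite coefD; apply: bmeasD. Qed.

Lemma bpolyN F : bpoly F -> bpoly (fun g => - F g).
Proof. by move=> bF i; under eq_fun do rewrite coefN; apply: bmeasN. Qed.

Lemma bpolyM F G : bpoly F -> bpoly G -> bpoly (fun g => F g * G g).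
Proof.
move=> bF bG i; under eq_fun do rewrite coefM.
by apply: bmeas_sum => j; apply: bmeasM.
Qed.

Lemma bpoly_sum (I : Type) (r : seq I) (P : pred I) (F : I -> mat -> {poly R}) :
  (forall i, bpoly (F i)) -> bpoly (fun x => \sum_(i <- r | P i) F i x).
Proof.
move=> bF i; under eq_fun do rewrite coef_sum.
by apply: bmeas_sum => j; apply: bF.
Qed.

Lemma bpoly_prod (I : Type) (r : seq I) (P : pred I) (F : I -> mat -> {poly R}) :
  (forall i, bpoly (F i)) -> bpoly (fun x => \prod_(i <- r | P i) F i x).
Proof.
move=> bF; elim: r => [|a r IH].
  by under eq_fun do rewrite big_nil; apply: bpoly_cst.
under eq_fun do rewrite big_cons.
by case: (P a) => //; apply: bpolyM.
Qed.

Lemma bpoly_rcp : bpoly (@rcp R n).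
Proof.
apply: bpoly_sum => s; apply: bpolyM; first exact: bpoly_cst.
apply: bpoly_prod => i; under eq_fun do rewrite !mxE.
apply: bpolyD; first exact: bpoly_cst.
apply: bpolyN; apply: bpolyM; first exact: bpoly_cst.
exact/bpolyC/bmeas_coord.
Qed.

Lemma bmeas_horner_rcp (A : mat -> mat) (x : R) :
  (forall i j, bmeas (fun g => A g i j)) -> bmeas (fun g => (rcp (A g)).[x]).
Proof.
move=> bA; under eq_fun do rewrite hornerE_rcp.
apply: bmeas_det => i j; under eq_fun do rewrite !mxE.
apply: bmeasD; first exact: bmeas_cst.
by apply: bmeasN; apply: bmeasM; first exact: bmeas_cst.
Qed.

Lemma bmeas_mul_coord (h : mat) i j : bmeas (fun g => (h *m g) i j).
Proof.
under eq_fun do rewrite mxE; apply: bmeas_sum => l.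
by apply: bmeasM; [apply: bmeas_cst | apply: bmeas_coord].
Qed.

Lemma bmeas_rot_beta a b (x : R) : bmeas (fun g => (rot_beta g a b).[x]).
Proof.
have bN i j : bmeas (fun g => (res_poly g i j).[x]).
  under eq_fun do rewrite horner_res_poly /res_mx !mxE.
  apply: bmeasM; first exact: bmeas_cst.
  apply: bmeas_sum => l; apply: bmeasM; first exact: bmeas_coord.
  under eq_fun do rewrite mxE; apply: bmeasM; first exact: bmeas_cst.
  apply: bmeas_det => u v; under eq_fun do rewrite !mxE.
  apply: bmeasD; first exact: bmeas_cst.
  by apply: bmeasN; apply: bmeasM; [apply: bmeas_cst | apply: bmeas_coord].
under eq_fun do rewrite hornerD hornerN.
by apply: bmeasD => //; apply: bmeasN.
Qed.

Lemma bmeas_rot_gamma a b (x : R) : bmeas (fun g => (rot_gamma g a b).[x]).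
Proof.
under eq_fun do rewrite hornerZ hornerD hornerN.
apply: bmeasM; first exact: bmeas_cst.
apply: bmeasD; first by apply: bmeas_horner_rcp => i j; apply: bmeas_mul_coord.
by apply: bmeasN; apply: bmeas_horner_rcp => i j; apply: bmeas_coord.
Qed.

(** This replaces differentiation under the integral: an identity for all values of t is read off
    coefficientwise, thanks to the uniform degree bound. *)
Lemma haar_int_coef d (F : mat -> {poly R}) (c : {poly R}) : bpoly F ->
  (forall g, size (F g) <= d)%N ->
  (forall t, haar_int (fun g => (F g).[t]) = c.[t]) ->
  forall i, haar_int (fun g => (F g)`_i) = c`_i.
Proof.
move=> bF sF E; pose Q := \poly_(i < d) haar_int (fun g => (F g)`_i).
suff QE : Q = c.
  move=> i; rewrite -QE coef_poly; case: ltnP => // di.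
  rewrite -[RHS](haar_int_cst 0); apply: eq_haar_int => g _.
  by rewrite nth_default // (leq_trans (sF g)).
apply: poly_eq_nat => l; rewrite -E horner_poly.
transitivity (haar_int (fun g => \sum_(i < d) l.+1%:R ^+ i * (F g)`_i)).
  rewrite haar_int_sumZ => [|i]; last exact: bF.
  by apply: eq_bigr => i _; rewrite mulrC.
apply: eq_haar_int => g _; rewrite (horner_coef_wide _ (sF g)).
by apply: eq_bigr => i _; rewrite mulrC.
Qed.

(** * The mean Laplacian vanishes *)

Section Laplacian.
Variables (k : nat) (x : 'I_k -> R).

Let p g j := (rcp (g : mat)).[x j].

(** The second derivative at t = 0 of the product of the [p g j] when g is rotated by t in the plane
    (a, b): there s' = 1, s'' = 0, q' = 0 and q'' = 1. *)
Definition rot_laplacian (g : mat) a b : R :=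
  \sum_j (rot_gamma g a b).[x j] * \prod_(l | l != j) p g l +
  \sum_j \sum_(i | i != j) (rot_beta g a b).[x j] * (rot_beta g a b).[x i] *
     \prod_(l | (l != j) && (l != i)) p g l.

Let bp j : bmeas (fun g => p g j).
Proof. by apply: bmeas_horner_rcp => u v; apply: bmeas_coord. Qed.

Lemma bmeas_rot_laplacian a b : bmeas (fun g => rot_laplacian g a b).
Proof.
apply: bmeasD; apply: bmeas_sum => j.
  by apply: bmeasM; [apply: bmeas_rot_gamma | apply: bmeas_prod].
apply: bmeas_sum => i; apply: bmeasM; last exact: bmeas_prod.
by apply: bmeasM; apply: bmeas_rot_beta.
Qed.

(* Rotating by the rational parametrisation of the circle, the integral of the
   product of the [p g j] is constant in [t]; the coefficient of [t ^ 2] is the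
   second derivative at the identity. *)
Lemma haar_rot_laplacian a b : a != b ->
  haar_int (fun g => rot_laplacian g a b) = 0.
Proof.
move=> ab; pose B g j := (rot_beta g a b).[x j].
pose G g j := (rot_gamma g a b).[x j].
(* With s = 2 t / (1 + t^2) and q = 2 t^2 / (1 + t^2), this is 1 + t^2 times the rotated factor. *)
pose F g j : {poly R} :=
  (p g j)%:P + (- (2 * B g j))%:P * 'X + (p g j + 2 * G g j)%:P * 'X^2.
pose Q g := \prod_j F g j.
pose E := haar_int (fun g => \prod_j p g j).
have bF j : bpoly (fun g => F g j).
  have bB := bmeas_rot_beta a b (x j); have bG := bmeas_rot_gamma a b (x j).
  have b2 := bmeas_cst 2.
  apply: bpolyD; [apply: bpolyD; [exact: bpolyC | apply: bpolyM] | apply: bpolyM];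
    try exact: bpoly_cst; apply: bpolyC.
    by apply: bmeasN; apply: bmeasM.
  by apply: bmeasD => //; apply: bmeasM.
have bQ : bpoly Q by apply: bpoly_prod.
have sF g j : (size (F g j) <= 3)%N.
  apply/leq_sizeP => -[|[|[|i]]] // _.
  by rewrite !coefD !coefCM !coefC coefX coefXn /= !mulr0 !addr0.
have sQ g : (size (Q g) <= (\sum_(j < k) 3).+1)%N.
  apply: (leq_trans (size_prod_leq _ _)); apply: (leq_trans (leq_subr _ _)).
  by rewrite ltnS; apply: leq_sum => j _.
have hQ t : haar_int (fun g => (Q g).[t]) = (E%:P * (1 + 'X^2) ^+ k).[t].
  pose w := 1 + t ^+ 2; have w0 : w != 0.
    by rewrite gt_eqF // ltr_pwDl // sqr_ge0.
  pose s := 2 * t / w; pose q := 2 * t ^+ 2 / w.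
  have sq : s ^+ 2 + q ^+ 2 = q *+ 2.
    by rewrite /s /q /w; field; exact: w0.
  have Srot : SO (plane_rot a b s q).
    by split; [apply: rot_orthogonal | apply: det_rot].
  transitivity (haar_int (fun g => w ^+ k * \prod_j (rcp (plane_rot a b s q *m g)).[x j])).
    apply: eq_haar_int => g _; rewrite /Q horner_prod.
    have -> : w ^+ k = \prod_(j < k) w by rewrite prodr_const card_ord.
    rewrite -big_split; apply: eq_bigr => j _ /=.
    have horner3 (p0 p1 p2 : {poly R}) y :
        (p0 - s *: p1 + q *: p2).[y] = p0.[y] - s * p1.[y] + q * p2.[y].
      by rewrite !(hornerD, hornerN, hornerZ).
    have -> : (F g j).[t] =
        p g j + - (2 * B g j) * t + (p g j + 2 * G g j) * t ^+ 2.
      by rewrite !(hornerD, hornerM, hornerC, hornerX, hornerXn).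
    rewrite rcp_rot // horner3 -/(p g j) -/(B g j) -/(G g j) /s /q /w.
    by field; exact: w0.
  rewrite haar_intZ; last first.
    apply: bmeas_prod => j; apply: bmeas_horner_rcp => u v.
    exact: bmeas_mul_coord.
  rewrite (haar_int_mul Srot (f := fun g => \prod_j p g j)); last exact: bmeas_prod.
  by rewrite hornerM hornerC horner_exp !hornerE mulrC.
have := haar_int_coef bQ sQ hQ 2; rewrite coefCM => Q2.
have k2 : ((1 + 'X^2 : {poly R}) ^+ k)`_2 *+ 2 = k%:R *+ 2.
  have := coef2_prod (fun _ : 'I_k => 1 + 'X^2 : {poly R}).
  rewrite prodr_const card_ord => ->.
  rewrite [X in _ + X]big1 ?addr0 => [|j _]; last first.
    by rewrite big1 // => i _; rewrite coefD coef1 coefXn /= addr0 !mul0r.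
  transitivity (\sum_(j < k) (2 : R)); last first.
    by rewrite sumr_const card_ord -mulrnA mulnC mulrnA.
  apply: eq_bigr => j _; rewrite big1 ?mulr1 => [|l _].
    by rewrite coefD coef1 coefXn /= add0r.
  by rewrite coefD coef1 coefXn /= addr0.
(* The first term comes from the cleared denominator (1 + t^2)^k; its mean cancels against the
   coefficient of t^2 on the other side. *)
have Q2E g : (Q g)`_2 = k%:R * \prod_j p g j + 2 * rot_laplacian g a b.
  have F0 j : (F g j)`_0 = p g j.
    by rewrite !coefD !coefCM !coefC coefX coefXn /= !mulr0 !addr0.
  have F1 j : (F g j)`_1 = - (2 * B g j).
    by rewrite !coefD !coefCM !coefC coefX coefXn /= !mulr0 addr0 add0r mulr1.
  have F2 j : (F g j)`_2 = p g j + 2 * G g j.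
    by rewrite !coefD !coefCM !coefC coefX coefXn /= !mulr0 !add0r mulr1.
  apply: (@mulIf _ 2); first by rewrite pnatr_eq0.
  rewrite mulr_natr coef2_prod.
  have -> : k%:R * \prod_j p g j = \sum_(j < k) p g j * \prod_(l | l != j) p g l.
    transitivity (\sum_(j < k) \prod_l p g l).
      by rewrite sumr_const card_ord mulr_natl.
    apply: eq_bigr => j _.
    by rewrite (bigD1 j).
  set A := \sum_(j < k) p g j * _.
  pose S1 := \sum_j G g j * \prod_(l | l != j) p g l.
  pose S2 := \sum_j \sum_(i | i != j) B g j * B g i *
    \prod_(l | (l != j) && (l != i)) p g l.
  have -> : (A + 2 * rot_laplacian g a b) * 2 = (A + 2 * S1) * 2 + 4 * S2.
    by rewrite (_ : rot_laplacian g a b = S1 + S2) //; ring.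
  congr (_ + _).
    rewrite /A /S1 big_distrr -big_split big_distrl; apply: eq_bigr => j _ /=.
    rewrite F2 (eq_bigr (fun l => p g l)) => [|l _]; last exact: F0.
    by ring.
  rewrite /S2 big_distrr; apply: eq_bigr => j _ /=.
  rewrite big_distrr; apply: eq_bigr => i _ /=.
  rewrite !F1 (eq_bigr (fun l => p g l)) => [|l _]; last exact: F0.
  by ring.
move: Q2; under eq_fun do rewrite Q2E.
rewrite haar_intD; last 2 first.
- by apply: bmeasM; [apply: bmeas_cst | apply: bmeas_prod].
- by apply: bmeasM; [apply: bmeas_cst | apply: bmeas_rot_laplacian].
have bP : bmeas (fun g => \prod_j p g j) by exact: bmeas_prod.
have bL := bmeas_rot_laplacian a b.
rewrite !haar_intZ //.
have {k2} -> : ((1 + 'X^2 : {poly R}) ^+ k)`_2 = k%:R.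
  by apply: (@mulIf _ 2); rewrite ?pnatr_eq0 // !mulr_natr.
rewrite -/E mulrC -[RHS]addr0 => /addrI /eqP.
by rewrite mulf_eq0 pnatr_eq0 /= => /eqP.
Qed.

End Laplacian.

(** The sum is a difference of two traces: orthogonality evaluates the one with a transpose, giving
    the denominator 1 - y z, and the resolvent identity the other, giving y - z. *)
Lemma SO_radial_cross (g : mat) (y z : R) : SO g -> y != z -> y * z != 1 ->
  \sum_a \sum_(b | b != a) (rot_beta g a b).[y] * (rot_beta g a b).[z] =
  2 * laplace_cross n (rcp g) y z.
Proof.
move=> [gg _] yz yz1; pose p := rcp g.
have tr_res w : \tr (res_mx g w) = - theta p w.
  have := congr1 (fun q => q.[w]) (trace_res_poly g).
  rewrite /theta hornerN hornerM hornerX => <-; rewrite /mxtrace horner_sum.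
  by apply: eq_bigr => i _; rewrite horner_res_poly.
have d1 : y - z != 0 by rewrite subr_eq0.
have d2 : 1 - y * z != 0 by rewrite subr_eq0 eq_sym.
transitivity ((\tr (res_mx g y *m (res_mx g z)^T) -
    \tr (res_mx g y *m res_mx g z)) *+ 2).
  rewrite -sum_beta_beta; apply: eq_bigr => a _.
  rewrite [LHS]big_mkcond; apply: eq_bigr => b _.
  case: eqVneq => [->|_]; first by rewrite (subrr (res_mx g y a a)) mul0r.
  by rewrite !(hornerD, hornerN) !horner_res_poly.
move: (res_mx_tr_mul y z gg) (resolvent_identity g y z) (tr_res y) (tr_res z).
rewrite -!hornerE_rcp -/p; move: (res_mx g y) (res_mx g z) => A B E2 E1 tA tB.
have {}E1 : \tr (A *m B) =
    (z * p.[z] * - theta p y - y * p.[y] * - theta p z) / (y - z).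
  have := congr1 mxtrace E1; rewrite raddfB /= !mxtraceZ tA tB => <-.
  by rewrite mulrC mulKf.
have {}E2 : \tr (A *m B^T) = (y * z *
   (p.[y] * p.[z] *+ n + p.[z] * - theta p y + p.[y] * - theta p z)) / (1 - y * z).
  have := congr1 mxtrace E2; rewrite !(mxtraceZ, mxtraceD) mxtrace_scalar mxtrace_tr.
  by rewrite tA tB => <-; rewrite mulrC mulKf.
rewrite E1 E2 /laplace_cross -[_ *+ n]mulr_natr; field.
by rewrite d1 d2.
Qed.

Lemma sum_rot_laplacian k (x : 'I_k -> R) (g : mat) : SO g ->
  (forall i j, i != j -> x i != x j) -> (forall i j, i != j -> x i * x j != 1) ->
  \sum_a \sum_(b | b != a) rot_laplacian x g a b =
  2 * radial_laplacian n (rcp g) x.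
Proof.
move=> Sg x_inj x_inv; rewrite /rot_laplacian.
transitivity (\sum_a \sum_(b | b != a) \sum_j (rot_gamma g a b).[x j] *
      \prod_(l | l != j) (rcp g).[x l] +
    \sum_a \sum_(b | b != a) \sum_j \sum_(i | i != j)
      (rot_beta g a b).[x j] * (rot_beta g a b).[x i] *
      \prod_(l | (l != j) && (l != i)) (rcp g).[x l]).
  by rewrite -big_split; apply: eq_bigr => a _; rewrite -big_split.
rewrite /radial_laplacian mulrDr; congr (_ + _).
  under eq_bigr => a _ do rewrite exchange_big.
  rewrite exchange_big big_distrr /=; apply: eq_bigr => j _.
  under eq_bigr => a _ do rewrite -big_distrl.
  rewrite -big_distrl mulrA /=; congr (_ * _).
  transitivity ((\sum_a \sum_(b | b != a) rot_gamma g a b).[x j]).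
    by rewrite horner_sum; apply: eq_bigr => a _; rewrite horner_sum.
  rewrite sum_rot_gamma /laplace_diag /theta.
  by rewrite !(hornerZ, hornerD, hornerN, hornerM, hornerXn, hornerX).
under eq_bigr => a _ do rewrite exchange_big.
rewrite exchange_big big_distrr /=; apply: eq_bigr => j _.
under eq_bigr => a _ do rewrite exchange_big.
rewrite exchange_big big_distrr /=; apply: eq_bigr => i ij.
under eq_bigr => a _ do rewrite -big_distrl.
rewrite -big_distrl mulrA /=; congr (_ * _).
rewrite -SO_radial_cross ?x_inj ?x_inv //.
by apply: eq_bigr => a _; apply: eq_bigr => b _; rewrite mulrC.
Qed.

Lemma haar_radial_laplacian k (x : 'I_k -> R) (c : R) :
  (forall i j, i != j -> x i != x j) -> (forall i j, i != j -> x i * x j != 1) ->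
  haar_int (fun g => c * radial_laplacian n (rcp g) x) = 0.
Proof.
move=> x_inj x_inv; transitivity (haar_int (fun g => c / 2 *
    \sum_a \sum_(b | b != a) rot_laplacian x g a b)).
  by apply: eq_haar_int => g Sg; rewrite sum_rot_laplacian // -mulrA mulKf ?pnatr_eq0.
have bL a b := @bmeas_rot_laplacian k x a b.
rewrite haar_intZ; last by do 2 (apply: bmeas_sum => ?).
rewrite haar_int_sum; last by move=> a; apply: bmeas_sum.
rewrite big1 ?mulr0 // => a _; rewrite haar_int_sum // big1 // => b ba.
by rewrite haar_rot_laplacian // eq_sym.
Qed.

End HaarIntegral.

(** * The mean of a product of characteristic polynomials *)

Section AntipalindromicFactor.
Variables (K : numFieldType) (n : nat) (p : {poly K}).
Hypothesis size_p : (size p <= n.+1)%N.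
Hypothesis p0 : p`_0 = 1.
Hypothesis p_inv : forall y, y != 0 -> p.[y] = - (y ^+ n * p.[y^-1]).

Lemma antipal_horner m (f : {poly K}) : (size f <= m.+1)%N ->
  (forall y, y != 0 -> f.[y] = - (y ^+ m * f.[y^-1])) -> antipal m f.
Proof.
move=> sf fE; pose q := \poly_(a < m.+1) - f`_(m - a).
suff fq : f = q by move=> a am; rewrite [in RHS]fq coef_poly ltnS am opprK.
apply: poly_eq_nat => l; set y := l.+1%:R.
have y0 : y != 0 by rewrite pnatr_eq0.
rewrite fE // horner_poly (horner_coef_wide _ sf) big_distrr -sumrN /=.
rewrite (reindex_inj rev_ord_inj); apply: eq_bigr => a _ /=.
have am : (a <= m)%N by rewrite -ltnS.
rewrite subSS mulrCA mulNr; congr (- (_ * _)).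
by rewrite exprVn -expfB_cond ?(negPf y0) ?add0n ?leq_subr // subKn.
Qed.

Variable k : nat.
Let m := (n + 2 * (k - 1))%N.
Let f (i : 'I_k) := pal_basis K i * p.

Lemma size_pal_mul i : (size (f i) <= m.+1)%N.
Proof.
apply: (leq_trans (size_polyMleq _ _)).
rewrite -subn1 leq_subLR (leq_trans (leq_add (size_pal_basis K i) size_p)) //.
by rewrite /m; lia.
Qed.

Lemma antipal_pal_mul i : antipal m (f i).
Proof.
apply: antipal_horner; first exact: size_pal_mul.
move=> y y0; have yV0 : y^-1 != 0 by rewrite invr_eq0.
rewrite !(hornerM (pal_basis K i) p) !horner_pal_basis // p_inv // invrK.
rewrite /m mul2n -addnn !exprD.
rewrite [y^-1 + y]addrC exprVn; field; exact: expf_neq0.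
Qed.

Lemma coef_pal_mul (i r : 'I_k) : (i <= r)%N ->
  (f i)`_(k - r.+1) = (r == i)%:R.
Proof.
move=> ir; have rk := ltn_ord r; have ik := ltn_ord i.
rewrite coefM big_ord_recr /= subnn p0 mulr1 big1 ?add0r => [|l _].
  rewrite coef_pal_basis; last by lia.
  by congr (_%:R); rewrite -val_eqE /=; lia.
rewrite coef_pal_basis; last by have := ltn_ord l; lia.
by rewrite (_ : (_ == _) = false) ?mul0r //; have := ltn_ord l; lia.
Qed.

(** The right side is free of p. This serves for every g in SO(n), over the complex numbers, and for
    p = 1 - X. *)
Lemma pal_alternant_collapse (x : 'I_k -> K) : (1 <= n)%N -> (1 <= k)%N ->
  \sum_(a : {ffun 'I_k -> 'I_m.+1} | [forall j, minn (a j) (m - a j) < k]%N)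
    (\prod_j x j ^+ a j) * \det (\matrix_(i, j) (f i)`_(a j)) =
  \det (\matrix_(i < k, j < k) (x j ^+ (k - i.+1) - x j ^+ (m - (k - i.+1)))).
Proof.
move=> n1 k1; apply: alternant_collapse.
- by rewrite /m; lia.
- exact: antipal_pal_mul.
- by move=> i r ir; rewrite coef_pal_mul ?(ltnW ir) // -val_eqE /= gtn_eqF.
by move=> i; rewrite coef_pal_mul // eqxx.
Qed.

Lemma det_pal_mul (x : 'I_k -> K) :
  \det (pal_mx x) * \prod_j p.[x j] =
  \sum_(a : {ffun 'I_k -> 'I_m.+1})
    (\prod_j x j ^+ a j) * \det (\matrix_(i, j) (f i)`_(a j)).
Proof.
rewrite mulrC -det_scale_col -(@det_horner_col _ _ _ (fun i _ => f i)) => [|i _].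
  by congr (\det _); apply/matrixP => i j; rewrite !mxE (hornerM (pal_basis K i) p) [RHS]mulrC.
exact: size_pal_mul.
Qed.

End AntipalindromicFactor.

(** Up to sign and a monomial, the Weyl alternant of the rectangular partition with its
    half-integral exponents shifted to natural numbers. *)
Definition half_alternant (K : comNzRingType) (k m : nat) (x : 'I_k -> K) : K :=
  \det (\matrix_(i < k, j < k) (x j ^+ (k - i.+1) - x j ^+ (m - (k - i.+1)))).

(* The case N = 0, where the factor det (1 - x g) is 1 - x. *)
Lemma det_pal_mx_half (K : numFieldType) (k : nat) (x : 'I_k -> K) : (1 <= k)%N ->
  \det (pal_mx x) * \prod_j (1 - x j) = half_alternant (1 + 2 * (k - 1)) x.
Proof.
move=> k1; pose p : {poly K} := 1 - 'X.
have size_p : (size p <= 2)%N.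
  by rewrite (leq_trans (size_polyD _ _)) // size_poly1 size_polyN size_polyX.
have p0 : p`_0 = 1 by rewrite coefB coef1 coefX subr0.
have p_inv y : y != 0 -> p.[y] = - (y ^+ 1 * p.[y^-1]).
  by move=> y0; rewrite /p !hornerE expr1; field.
rewrite /half_alternant -(pal_alternant_collapse size_p p0 p_inv) //.
transitivity (\det (pal_mx x) * \prod_j p.[x j]).
  by congr (_ * _); apply: eq_bigr => j _; rewrite /p !hornerE.
(* Here m = 2 k - 1, so every exponent up to m is low and the restricted sum is the full one. *)
rewrite (det_pal_mul size_p); apply: eq_bigl => a.
by apply/esym/forallP => j; have := ltn_ord (a j); lia.
Qed.

Lemma half_alternant_expand (K : fieldType) (k N : nat) (x : 'I_k -> K) :
  (1 <= k)%N -> (forall j, x j != 0) ->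
  (forall i j : 'I_k, (i < j)%N -> (x i - x j) * (1 - x i * x j) != 0) ->
  half_alternant ((2 * N).+1 + 2 * (k - 1)) x =
  \det (pal_mx x) * \sum_(b : {ffun 'I_k -> bool})
    (\prod_(j < k) eps K (b j)) * (\prod_(j < k) x j ^+ half_exp N (b j)) *
    \prod_(i < k) \prod_(j < k | (i < j)%N)
      (1 - x i ^ eps int (b i) * x j ^ eps int (b j))^-1.
Proof.
move=> k1 x0 xx; set m := ((2 * N).+1 + _)%N.
pose E (b : bool) (i : 'I_k) := if b then (m - (k - i.+1))%N else (k - i.+1)%N.
have T_expand : half_alternant m x = \sum_(b : {ffun 'I_k -> bool})
    (\prod_j eps K (b j)) * \det (\matrix_(i, j) x j ^+ E (b j) i).
  rewrite /half_alternant -det_tr [LHS]/determinant.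
  transitivity (\sum_s \sum_(b : {ffun 'I_k -> bool}) (-1) ^+ odd_perm s *
      \prod_j (eps K (b j) * x j ^+ E (b j) (s j))).
    apply: eq_bigr => s _; rewrite -big_distrr; congr (_ * _) => /=.
    rewrite -(bigA_distr_bigA (fun j (b : bool) => eps K b * x j ^+ E b (s j))).
    apply: eq_bigr => j _; rewrite !mxE big_bool /eps /E expr0 expr1.
    by rewrite mul1r mulN1r addrC.
  rewrite exchange_big /=; apply: eq_bigr => b _.
  rewrite -det_tr [X in _ * X]/determinant big_distrr; apply: eq_bigr => s _ /=.
  rewrite big_split /= [RHS]mulrCA; congr (_ * (_ * _)).
  by apply: eq_bigr => j _; rewrite !mxE.
rewrite T_expand big_distrr; apply: eq_bigr => b _ /=.
rewrite -!mulrA mulrCA; congr (_ * _).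
(* For both signs the exponent in row i, counted from 0, is [half_exp] + (k - 1) - eps i: each
   choice of signs leaves a Vandermonde matrix in the inverses of the [e j]. *)
pose e j := x j ^ eps int (b j).
have e0 j : e j != 0 by rewrite expfz_neq0.
have -> : \det (\matrix_(i, j) x j ^+ E (b j) i) =
    (\prod_j x j ^+ half_exp N (b j)) * ((\prod_j x j ^+ (k - 1)) *
     \prod_(i < k) \prod_(j < k | (i < j)%N) ((e j)^-1 - (e i)^-1)).
  transitivity (\det (\matrix_(i, j) (x j ^+ half_exp N (b j) * x j ^+ (k - 1) *
     Vandermonde k (\row_j (e j)^-1) i j))).
    congr (\det _); apply/matrixP => i j; rewrite !mxE /e /E /eps /half_exp.
    have ik := ltn_ord i; case: (b j).
      rewrite expr1 exprN1 invrK -!exprD; congr (_ ^+ _); rewrite /m; lia.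
    rewrite expr0 expr1z mul1r exprVn -expfB_cond; last first.
      by rewrite (negPf (x0 j)); lia.
    by congr (_ ^+ _); lia.
  rewrite det_scale_col big_split /= mulrA det_Vandermonde; congr (_ * _).
  apply: eq_bigr => i _; apply: eq_bigr => j _; by rewrite !mxE.
rewrite [RHS]mulrCA; congr (_ * _).
(* For all signs, x_i x_j (1/e_j - 1/e_i) (1 - e_i e_j) = (x_i - x_j) (1 - x_i x_j), which is the
   factor of W. *)
rewrite -prod_pairs det_pal_mx // -!big_split; apply: eq_bigr => i _ /=.
rewrite -!big_split; apply: eq_bigr => j ij /=.
have := xx i j ij; rewrite mulf_eq0 negb_or => /andP[d1 d2].
have xi := x0 i; have xj := x0 j; rewrite /e /eps.
have d1' : x j - x i != 0 by rewrite -opprB oppr_eq0.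
have d2' : x i * x j - 1 != 0 by rewrite -opprB oppr_eq0.
have expF y : y ^ (-1) ^+ false = y :> K by rewrite expr0 expr1z.
have expT y : y ^ (-1) ^+ true = y^-1 :> K by rewrite expr1 exprN1.
by case: (b i); case: (b j); rewrite ?expF ?expT; field;
  rewrite ?xi ?xj ?d1 ?d1' ?d2 ?d2' ?oner_neq0.
Qed.

Lemma det_orthogonal_inv (K : fieldType) (n : nat) (g : 'M[K]_n) (y : K) :
  odd n -> g *m g^T = 1%:M -> \det g = 1 -> y != 0 ->
  \det (1%:M - y *: g) = - (y ^+ n * \det (1%:M - y^-1 *: g)).
Proof.
move=> odd_n gg dg y0.
have E : (1%:M - y *: g) *m g^T = (- y) *: (1%:M - y^-1 *: g)^T.
  rewrite mulmxBl mul1mx -scalemxAl gg; apply/matrixP => i j.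
  by rewrite !mxE (eq_sym j); field.
have := congr1 determinant E; rewrite det_mulmx det_tr dg mulr1 => ->.
by rewrite detZ det_tr exprNn -signr_odd odd_n expr1 mulN1r mulNr.
Qed.

(** * The mean over SO(2N+1) as an alternant and as a Laurent polynomial *)

Section SpecialOrthogonalMean.
Variables (R : realType) (N k : nat) (mu : probability (borel_mx R (2 * N).+1) R).
Hypothesis hmu : is_SO_haar mu.
Hypothesis k1 : (1 <= k)%N.

Let n := (2 * N).+1.
Let m := (n + 2 * (k - 1))%N.
Local Notation mat := 'M[R]_n.
Local Notation rc := (real_complex R).

Lemma horner_rcp_SO_inv (g : mat) (y : R) : SO g -> y != 0 ->
  (rcp g).[y] = - (y ^+ n * (rcp g).[y^-1]).
Proof.
by move=> [gg dg] y0; rewrite !hornerE_rcp det_orthogonal_inv //= oddM.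
Qed.

Lemma horner_rcp_SO1 (g : mat) : SO g -> (rcp g).[1] = 0.
Proof.
move=> Sg; have := horner_rcp_SO_inv Sg (oner_neq0 R).
rewrite expr1n mul1r invr1 => /eqP; rewrite -addr_eq0 -mulr2n mulrn_eq0 /=.
by move/eqP.
Qed.

(* The coefficient of \prod_j x j ^+ a j in
   \det (pal_mx x) * \prod_j det (1 - x j g). *)
Definition SO_coef (a : {ffun 'I_k -> 'I_m.+1}) (g : mat) : R :=
  \det (\matrix_(i, j) (pal_basis R i * rcp g)`_(a j)).

Lemma bmeas_SO_coef a : bmeas (SO_coef a).
Proof.
apply: bmeas_det => i j; under eq_fun do rewrite mxE.
by apply: bpolyM; [apply: bpoly_cst | apply: bpoly_rcp].
Qed.

(** At each grid point, weighting the monomials by the eigenvalue defect gives the mean of W times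
    the radial Laplacian, hence 0; the grid then separates the monomials. *)
Lemma haar_SO_coef_eigen (a : {ffun 'I_k -> 'I_m.+1}) :
  (\sum_j (a j)%:R * ((a j)%:R - m%:R) - \sum_(i < k) i%:R * (i%:R - m%:R)) *
    haar_int mu (SO_coef a) = 0.
Proof.
(* Distinct integers at least 2: on this grid no x i - x j nor 1 - x i * x j
   vanishes. *)
pose t (j : 'I_k) (r : 'I_m.+1) : R := (j * m.+1 + r + 2)%:R.
have tE j j' (r r' : 'I_m.+1) : t j r = t j' r' -> j = j' /\ r = r'.
  move/eqP; rewrite eqr_nat !addn2 !eqSS => /eqP E.
  have E2 : (j = j' :> nat).
    have := congr1 (divn^~ m.+1) E.
    by rewrite !divnMDl // !divn_small ?ltn_ord // !addn0.
  split; apply: val_inj => //=; move: E; rewrite E2.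
  exact: addnI.
have t_ge j r : 2 <= t j r by rewrite ler_nat; lia.
move: a; apply: (coef_eq0_grid (t := t)) => [j r r' /tE[] // | r].
pose x j := t j (r j).
have x0 j : x j != 0 by rewrite gt_eqF // (lt_le_trans _ (t_ge _ _)).
have x_inj i j : i != j -> x i != x j.
  by apply: contraNneq => /tE[->].
have x_inv i j : i != j -> x i * x j != 1.
  move=> _; rewrite gt_eqF // (@lt_le_trans _ _ (2 * 2)) //.
    by rewrite -natrM ltr1n.
  by rewrite ler_pM // t_ge.
pose c : R := \sum_(i < k) i%:R * (i%:R - m%:R).
pose lam (a : {ffun 'I_k -> 'I_m.+1}) : R := \sum_j (a j)%:R * ((a j)%:R - m%:R).
pose mon (a : {ffun 'I_k -> 'I_m.+1}) := \prod_j x j ^+ a j.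
transitivity (\sum_(a : {ffun 'I_k -> 'I_m.+1})
    ((lam a - c) * mon a) * haar_int mu (SO_coef a)).
  by apply: eq_bigr => a _; rewrite mulrAC.
rewrite -haar_int_sumZ //; last exact: bmeas_SO_coef.
transitivity (haar_int mu (fun g => \det (pal_mx x) * radial_laplacian n (rcp g) x)).
  apply: eq_haar_int => g Sg.
  have sf i := size_pal_mul (size_rcp g) i.
  have := sum_euler_alternant n (rcp g) x0 x_inj x_inv.
  rewrite (@sum_det_euler_op _ _ m m.+1) => [E|i]; last exact: sf.
  have := det_pal_mul (size_rcp g) x => E2.
  rewrite -[RHS](addrK (c * (\det (pal_mx x) * \prod_j (rcp g).[x j]))).
  rewrite -E E2 big_distrr -sumrB; apply: eq_bigr => a _ /=.
  by rewrite /SO_coef -/(mon a) -/(lam a); ring.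
exact: haar_radial_laplacian.
Qed.

(** With repeated or complementary exponents the coefficient vanishes for each g; otherwise
    [eigenvalue_low] shows that the eigenvalue is wrong. *)
Lemma haar_SO_coef_eq0 (a : {ffun 'I_k -> 'I_m.+1}) :
  ~~ [forall j, minn (a j) (m - a j) < k]%N ->
  haar_int mu (SO_coef a) = 0.
Proof.
move=> high; have am j : (a j <= m)%N by rewrite -ltnS.
have zero i j : i != j -> (a i : nat) = a j \/ (a i + a j)%N = m ->
    haar_int mu (SO_coef a) = 0.
  move=> ij aij; rewrite -[RHS](haar_int_cst hmu 0); apply: eq_haar_int => g Sg.
  apply: (det_coef_eq0 (a := fun j => a j) _ am ij aij) => l.
  apply: antipal_pal_mul; first exact: size_rcp.
  by move=> y y0; apply: horner_rcp_SO_inv.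
have [inj|ninj] := boolP (injectiveb (fun j => a j : nat)); last first.
  have /injectivePn[i [j ij aij]] := ninj.
  by apply: (zero i j) => //; left.
have [/existsP[i /existsP[j /andP[ij /eqP aij]]]|nsum] :=
    boolP [exists i, exists j, (i != j) && (a i + a j == m)%N].
  by apply: (zero i j) => //; right.
have /eqP := haar_SO_coef_eigen a; rewrite mulf_eq0 subr_eq0 => /orP[|/eqP //].
have mE : m = (2 * (N + (k - 1))).+1 by rewrite /m /n; lia.
move=> /eqP E; case/negP: high; apply/forallP.
have := @eigenvalue_low R k (N + (k - 1)) (fun j => a j).
rewrite -mE; apply=> //; first by lia.
  by apply/injectiveP.
move=> i j ij; apply: contra nsum => /eqP aij.
by apply/existsP; exists i; apply/existsP; exists j; rewrite ij aij eqxx.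
Qed.

(** Complex coefficients times real functions of g: linearity then reduces to real integrals of the
    real and imaginary parts. *)
Lemma SO_expectation_sum (J : finType) (P : pred J) (z : J -> R[i])
    (c : J -> mat -> R) (f : mat -> R[i]) :
  (forall j, bmeas (c j)) ->
  (forall g, SO g -> f g = \sum_(j | P j) z j * (c j g)%:C) ->
  SO_expectation mu f = \sum_(j | P j) z j * (haar_int mu (c j))%:C.
Proof.
move=> bc fE.
have ReD : {morph (@complex.Re R) : u v / u + v} by move=> [? ?] [? ?].
have ImD : {morph (@complex.Im R) : u v / u + v} by move=> [? ?] [? ?].
have ReZ u (r : R) : complex.Re (u * r%:C) = complex.Re u * r.
  by case: u => u v /=; rewrite mulr0 subr0.
have ImZ u (r : R) : complex.Im (u * r%:C) = complex.Im u * r.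
  by case: u => u v /=; rewrite mulr0 add0r.
have lin (w : R[i] -> R) : w 0 = 0 -> {morph w : u v / u + v} ->
    (forall u r, w (u * r%:C) = w u * r) ->
    haar_int mu (fun g => w (f g)) =
    w (\sum_(j | P j) z j * (haar_int mu (c j))%:C).
  move=> w0 wD wZ; rewrite (big_morph w wD w0).
  under [RHS]eq_bigr => j _ do rewrite wZ.
  transitivity (haar_int mu (fun g => \sum_(j | P j) w (z j) * c j g)).
    apply: eq_haar_int => g Sg; rewrite fE // (big_morph w wD w0).
    by apply: eq_bigr => j _; rewrite wZ.
  rewrite haar_int_sum // => [|j].
    by apply: eq_bigr => j _; rewrite haar_intZ.
  by apply: bmeasM => //; apply: bmeas_cst.
apply/eqP; rewrite eq_complex /SO_expectation /=.
apply/andP; split; apply/eqP.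
  exact: (lin (@complex.Re R)).
exact: (lin (@complex.Im R)).
Qed.

Section FixedPoint.
Variable x : 'I_k -> R[i].
Let W := \det (pal_mx x).
Let char_prod (g : mat) := \prod_(j < k) \det (1%:M - x j *: map_mx rc g).

Lemma SO_mean_alternant :
  W * SO_expectation mu char_prod = half_alternant m x.
Proof.
have char_prodE g : char_prod g = \prod_j (map_poly rc (rcp g)).[x j].
  by apply: eq_bigr => j _; rewrite horner_rcp.
pose mon (a : {ffun 'I_k -> 'I_m.+1}) := \prod_j x j ^+ a j.
have size_map g : (size (map_poly rc (rcp (g : mat))) <= n.+1)%N.
  by rewrite size_map_poly size_rcp.
have coef_mapE g (a : {ffun 'I_k -> 'I_m.+1}) :
    \det (\matrix_(i, j) (pal_basis R[i] i * map_poly rc (rcp g))`_(a j)) =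
    (SO_coef a g)%:C.
  transitivity (\det (map_mx rc (\matrix_(i, j) (pal_basis R i * rcp g)`_(a j)))).
    congr (\det _); apply/matrixP => i j.
    rewrite !mxE; have -> : pal_basis R[i] i = map_poly rc (pal_basis R i).
      rewrite /pal_basis /pal_mon rmorphM !rmorphXn /= rmorphD rmorph1 rmorphXn /=.
      by rewrite map_polyX.
    by rewrite -rmorphM coef_map.
  exact: (det_map_mx rc).
transitivity (SO_expectation mu (fun g => W * char_prod g)).
  pose z (e : {ffun 'I_k -> 'I_n.+1}) := \prod_j x j ^+ e j.
  pose c (e : {ffun 'I_k -> 'I_n.+1}) (g : mat) := \prod_j (rcp g)`_(e j).
  have bc e : bmeas (c e) by apply: bmeas_prod => j; apply: bpoly_rcp.
  have fE g : char_prod g = \sum_e z e * (c e g)%:C.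
    rewrite char_prodE; transitivity (\prod_j \sum_(l < n.+1)
        ((rcp g)`_l)%:C * x j ^+ l).
      apply: eq_bigr => j _; rewrite (horner_coef_wide _ (size_map g)).
      by apply: eq_bigr => l _; rewrite coef_map.
    rewrite bigA_distr_bigA; apply: eq_bigr => e _ /=.
    by rewrite big_split /= mulrC -[(c e g)%:C]/(rc _) rmorph_prod.
  rewrite (SO_expectation_sum (P := xpredT) bc (fun g _ => fE g)).
  rewrite (SO_expectation_sum (P := xpredT) (z := fun e => W * z e) bc) => [|g _].
    by rewrite big_distrr; apply: eq_bigr => e _ /=; rewrite mulrA.
  by rewrite fE big_distrr; apply: eq_bigr => e _ /=; rewrite mulrA.
rewrite (SO_expectation_sum (P := xpredT) (z := mon) bmeas_SO_coef) => [|g _].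
  pose low := fun a : {ffun 'I_k -> 'I_m.+1} =>
    [forall j, minn (a j) (m - a j) < k]%N.
  (* For each g the low part of the expansion equals this constant, so its mean is known; the high
     coefficients have mean 0. *)
  transitivity (SO_expectation mu (fun g => half_alternant m x)); last first.
    rewrite (SO_expectation_sum (P := xpredT) (J := unit)
      (z := fun=> half_alternant m x) (c := fun _ _ => 1)).
    - by rewrite big_const card_unit /= haar_int_cst // mulr1 addr0.
    - by move=> _; apply: bmeas_cst.
    - by move=> g _; rewrite big_const card_unit /= mulr1 addr0.
  rewrite (SO_expectation_sum (P := low) (z := mon) bmeas_SO_coef) => [|g Sg].
    rewrite [RHS]big_mkcond; apply: eq_bigr => a _; case: ifPn => // /haar_SO_coef_eq0 ->.
    by rewrite mulr0.
  have p0 : (map_poly rc (rcp g))`_0 = 1 by rewrite coef_map rcp0.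
  have p_inv y : y != 0 -> (map_poly rc (rcp g)).[y] =
      - (y ^+ n * (map_poly rc (rcp g)).[y^-1]).
    move=> y0; rewrite !horner_rcp; apply: det_orthogonal_inv => //.
    - by rewrite /= oddM.
    - by rewrite map_trmx -map_mxM; case: Sg => -> _; rewrite map_mx1.
    - by rewrite det_map_mx; case: Sg => _ ->; rewrite rmorph1.
  rewrite /half_alternant -(pal_alternant_collapse (size_map g) p0 p_inv) //.
  by apply: eq_bigr => a _; rewrite coef_mapE.
rewrite char_prodE (det_pal_mul (size_map g)).
by apply: eq_bigr => a _; rewrite coef_mapE.
Qed.

End FixedPoint.

(** This produces the candidate for the character, with values also at points where some x_j = 1. *)
Lemma SO_mean_laurent : exists P : laurent R k,
  forall x : 'I_k -> R[i], (forall j, x j != 0) ->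
  SO_expectation mu (fun g =>
    \prod_(j < k) \det (1%:M - x j *: map_mx rc g)) =
  (\prod_j x j) ^+ N * \prod_j (1 - x j) * leval P x.
Proof.
(* Partial sums of coefficients are the coefficients of det (1 - y g) / (1 - y). The one at n is the
   value at y = 1, which is 0, so the degrees are 0..2N, and the shift by N centres them. *)
pose q (g : mat) (l : nat) : R := \sum_(i < l.+1) (rcp g)`_i.
pose qprod (e : 'I_k -> nat) (g : mat) := \prod_j q g (e j).
have bq e : bmeas (qprod e).
  by apply: bmeas_prod => j; apply: bmeas_sum => i; apply: bpoly_rcp.
pose v (e : {ffun 'I_k -> int}) : R[i] :=
  (haar_int mu (qprod (fun j => absz (e j + N%:Z))))%:C.
pose shift (a : {ffun 'I_k -> 'I_n}) : {ffun 'I_k -> int} :=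
  [ffun j => (a j)%:Z - N%:Z].
have shift_inj : injective shift.
  move=> a b /ffunP ab; apply/ffunP => j; apply: val_inj.
  by have := ab j; rewrite !ffunE => /addIr [].
pose s := [seq shift a | a <- enum {: {ffun 'I_k -> 'I_n}}].
have s_uniq : uniq s by rewrite map_inj_uniq ?enum_uniq.
pose P : laurent R k := [fsfun e in [fset e in s]%fset => v e | 0].
have PE e : e \in s -> P e = v e by move=> es; rewrite fsfunE inE /= es.
have sum_P (F : {ffun 'I_k -> int} -> R[i]) :
    \sum_(e <- finsupp P) P e * F e = \sum_a v (shift a) * F (shift a).
  transitivity (\sum_(e <- s) P e * F e).
    rewrite [RHS](bigID (mem (finsupp P))) /= [X in _ + X]big1 ?addr0.
      rewrite -[RHS]big_filter; apply: perm_big; apply: uniq_perm.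
      - exact: fset_uniq.
      - exact: filter_uniq.
      move=> e; rewrite mem_filter; case: (boolP (e \in finsupp P)) => //= eP.
      move: eP; rewrite mem_finsupp fsfunE inE /=.
      by case: (e \in s) => //; rewrite eqxx.
    by move=> e /fsfun_dflt ->; rewrite mul0r.
  rewrite big_map big_enum /=; apply: eq_bigr => a _.
  by rewrite PE // map_f // mem_enum.
exists P => x x0.
pose mon (a : {ffun 'I_k -> 'I_n}) := \prod_j x j ^+ a j.
have telescope g (y : R[i]) : SO g ->
    (map_poly rc (rcp g)).[y] = (1 - y) * \sum_(l < n) (q g l)%:C * y ^+ l.
  move=> Sg; have qn : q g n = 0.
    rewrite -(horner_rcp_SO1 Sg) (horner_coef_wide _ (size_rcp g)).
    by apply: eq_bigr => i _; rewrite expr1n mulr1.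
  rewrite (@horner_coef_wide _ n.+1) ?size_map_poly ?size_rcp //.
  rewrite (eq_bigr (fun l : 'I_n.+1 => ((rcp g)`_l)%:C * y ^+ l)); last first.
    by move=> l _; rewrite coef_map.
  have gen h : \sum_(l < h.+1) ((rcp g)`_l)%:C * y ^+ l =
      (1 - y) * \sum_(l < h) (q g l)%:C * y ^+ l + (q g h)%:C * y ^+ h.
    elim: h => [|h IH]; first by rewrite big_ord0 mulr0 add0r big_ord1 /q big_ord1.
    rewrite big_ord_recr IH /= [in RHS]big_ord_recr /=.
    have -> : q g h.+1 = q g h + (rcp g)`_h.+1 by rewrite /q big_ord_recr.
    rewrite (rmorphD rc) /= exprS; ring.
  by rewrite gen qn mul0r addr0.
rewrite (SO_expectation_sum (P := xpredT)
   (z := fun a => \prod_j (1 - x j) * mon a) (fun a => bq (fun j => a j))); last first.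
  move=> g Sg; transitivity (\prod_j ((1 - x j) * \sum_(l < n) (q g l)%:C * x j ^+ l)).
    by apply: eq_bigr => j _; rewrite -telescope // horner_rcp.
  rewrite big_split /= bigA_distr_bigA big_distrr; apply: eq_bigr => a _ /=.
  rewrite -mulrA; congr (_ * _).
  by rewrite big_split /= mulrC -[(qprod _ g)%:C]/(rc _) rmorph_prod.
rewrite /leval sum_P big_distrr; apply: eq_bigr => a _ /=.
have -> : v (shift a) = (haar_int mu (qprod (fun j => a j)))%:C.
  congr ((haar_int mu _)%:C); apply/funext => g; apply: eq_bigr => j _.
  by rewrite ffunE subrK.
have -> : \prod_j x j ^ shift a j = mon a / (\prod_j x j) ^+ N.
  rewrite -prodrXl -prodf_div; apply: eq_bigr => j _.
  by rewrite ffunE expfzDr // exprnN.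
have X0 : (\prod_j x j) ^+ N != 0.
  by apply: expf_neq0; apply/prodf_neq0 => j _.
by field.
Qed.

End SpecialOrthogonalMean.

(** In these three lemmas A and A0 stand for the alternants in y, H and H0 for the half alternants
    in x = y^2, X for (\prod x)^N, Y for \prod y^(2 k - 1), s for [reversal_sign], w for W, d for
    \prod (1 - x_j), L for the Laurent polynomial's value and E for the mean. *)
Lemma cross_cancel (K : fieldType) (s Y X A A0 H H0 : K) :
  s != 0 -> Y != 0 -> A * (X * Y) = s * H -> A0 * Y = s * H0 ->
  A * H0 * X = A0 * H.
Proof.
move=> s0 y0 HA HA0; apply: (mulfI s0); apply: (mulfI y0).
transitivity (A * (X * Y) * (s * H0)); first by ring.
by rewrite HA -HA0; ring.
Qed.

Lemma cross_div (K : fieldType) (w d X L A A0 H H0 : K) :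
  A0 != 0 -> X != 0 -> H0 != 0 -> w * (X * d * L) = H -> w * d = H0 ->
  A * H0 * X = A0 * H -> L = A / A0.
Proof.
move=> a0 x0 h0 H1 H2 H3; apply: (mulIf a0); rewrite divfK //.
apply: (mulIf x0); apply: (mulIf h0); rewrite -[RHS]mulrAC H3 -H1 -H2; ring.
Qed.

Lemma cross_mul (K : fieldType) (w d X E A A0 H H0 : K) :
  w != 0 -> A0 != 0 -> w * E = H -> w * d = H0 ->
  A * H0 * X = A0 * H -> E = X * d * (A / A0).
Proof.
move=> w0 a0 H1 H2 H3; apply: (mulfI w0); rewrite H1; apply: (mulfI a0).
by rewrite -H3 -H2; field.
Qed.

Section Alternants.
Variables (R : realType) (k : nat).

(** The rows of the two kinds of alternants come in opposite orders, and their entries have opposite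
    signs. *)
Definition reversal_sign : R[i] :=
  (-1) ^+ k * \det (perm_mx (perm (@rev_ord_inj k))).

Lemma reversal_sign_neq0 : reversal_sign != 0.
Proof. by rewrite /reversal_sign det_perm mulf_neq0 ?signr_eq0. Qed.

Lemma SO_alternant_half (N : nat) (y : 'I_k -> R[i]) : (forall j, y j != 0) ->
  SO_alternant (nseq k N) y * \prod_j y j ^+ (2 * N + (2 * k - 1)) =
  reversal_sign * half_alternant ((2 * N).+1 + 2 * (k - 1)) (fun j => y j ^+ 2).
Proof.
move=> y0; rewrite mulrC /SO_alternant -det_scale_col /reversal_sign -mulrA.
rewrite /half_alternant -det_mulmx -row_permE -detZ.
congr (\det _); apply/matrixP => i j; rewrite !mxE permE /=.
have ik := ltn_ord i; rewrite nth_nseq ik; set o := (2 * _).+1.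
have -> : (k - (k - i.+1).+1 = i)%N by lia.
set m := ((2 * N).+1 + _)%N; have yj := y0 j.
have e1 : (2 * N + (2 * k - 1) + o = 2 * (m - i))%N by rewrite /o /m; lia.
have e2 : (2 * N + (2 * k - 1) = o + 2 * i)%N by rewrite /o; lia.
rewrite mulrBr -exprD e1 e2 exprD !exprM [y j ^+ o * _]mulrC mulfK ?expf_neq0 //.
by rewrite mulN1r opprB.
Qed.

Lemma SO_alternant_nil (y : 'I_k -> R[i]) :
  SO_alternant [::] y = SO_alternant (nseq k 0%N) y.
Proof.
rewrite /SO_alternant; congr (\det _); apply/matrixP => i j; rewrite !mxE nth_nseq nth_nil.
by rewrite if_same.
Qed.

Lemma SO_alternant_cross (N : nat) (y : 'I_k -> R[i])
    (x := fun j => y j ^+ 2) : (forall j, y j != 0) ->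
  SO_alternant (nseq k N) y * half_alternant (1 + 2 * (k - 1)) x *
    (\prod_j x j) ^+ N =
  SO_alternant [::] y * half_alternant ((2 * N).+1 + 2 * (k - 1)) x.
Proof.
move=> y0; have hN := SO_alternant_half N y0; have h0 := SO_alternant_half 0 y0.
have Y0 : \prod_j y j ^+ (2 * k - 1) != 0.
  by apply/prodf_neq0 => j _; apply: expf_neq0.
have YN : \prod_j y j ^+ (2 * N + (2 * k - 1)) =
    (\prod_j x j) ^+ N * \prod_j y j ^+ (2 * k - 1).
  rewrite -prodrXl -big_split; apply: eq_bigr => j _ /=.
  by rewrite exprD exprM.
rewrite -SO_alternant_nil in h0; move: hN h0; rewrite YN muln0 add0n -/x.
move=> hN h0; exact: (cross_cancel reversal_sign_neq0 Y0 hN h0).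
Qed.

End Alternants.

Theorem proposition16 (R : realType) (N k : nat) (hN : (1 <= N)%N)
    (hk : (1 <= k)%N) (x : 'I_k -> R[i])
    (hx0 : forall i : 'I_k, x i != 0)
    (hx1 : forall i j : 'I_k, (i < j)%N -> x i != x j)
    (hx2 : forall i j : 'I_k, (i < j)%N -> x i * x j != 1)
    (mu : probability (borel_mx R (2 * N).+1) R) (hmu : is_SO_haar mu) :
  SO_expectation mu (fun g =>
      \prod_(j < k) \det (1%:M - x j *: map_mx (real_complex R) g))
    = (\prod_(j < k) x j) ^+ N * \prod_(j < k) (1 - x j)
      * leval (SO_char R k (nseq k N)) x
  /\
  (\prod_(j < k) x j) ^+ N * \prod_(j < k) (1 - x j)
      * leval (SO_char R k (nseq k N)) x
    = \sum_(b : {ffun 'I_k -> bool})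
        (\prod_(j < k) eps R[i] (b j)) *
        (\prod_(j < k) x j ^+ half_exp N (b j)) *
        \prod_(i < k) \prod_(j < k | (i < j)%N)
           (1 - x i ^ eps int (b i) * x j ^ eps int (b j))^-1.
Proof.
have xx (i j : 'I_k) : (i < j)%N -> (x i - x j) * (1 - x i * x j) != 0.
  by move=> ij; rewrite mulf_neq0 // subr_eq0 ?hx1 // eq_sym hx2.
pose W := \det (pal_mx x).
have W0 : W != 0.
  rewrite /W det_pal_mx //; apply/prodf_neq0 => i _; apply/prodf_neq0 => j.
  exact: xx.
have [P0 P0E] := @SO_mean_laurent R N k mu hmu.
have P0_char : is_SO_char (nseq k N) P0.
  move=> y y0 alt0; pose x2 j := y j ^+ 2.
  have x20 j : x2 j != 0 by rewrite expf_neq0.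
  have := SO_mean_alternant hmu hk x2; rewrite P0E // => H1.
  have H2 := det_pal_mx_half x2 hk.
  have H3 := SO_alternant_cross N y0.
  have X0 : (\prod_j x2 j) ^+ N != 0.
    by apply: expf_neq0; apply/prodf_neq0 => j _.
  have h0 : half_alternant (1 + 2 * (k - 1)) x2 != 0.
    have := SO_alternant_half 0 y0; rewrite -SO_alternant_nil => E.
    apply: contraNneq alt0 => h0; move/eqP: E; rewrite h0 mulr0 mulf_eq0.
    case/orP=> // /prodf_eq0[j _]; rewrite expf_eq0 (negPf (y0 j)) andbF //.
  exact: (cross_div alt0 X0 h0 H1 H2 H3).
(* [SO_char] need not be [P0] by definition; existence of [P0] gives it the quotient formula, which
   is all that is used below. *)
have P_char : is_SO_char (nseq k N) (SO_char R k (nseq k N)).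
  exact: (@xgetPex _ _ [set P | is_SO_char (nseq k N) P] (ex_intro _ P0 P0_char)).
set E := SO_expectation _ _.
have WE : W * E = half_alternant ((2 * N).+1 + 2 * (k - 1)) x.
  exact: SO_mean_alternant.
have EP : E = (\prod_(j < k) x j) ^+ N * \prod_(j < k) (1 - x j)
      * leval (SO_char R k (nseq k N)) x.
  (* If some x_j = 1, column j of the alternant is zero and both sides vanish. Otherwise the Weyl
     denominator is nonzero, being W times this product up to a nonzero factor, and the quotient
     formula applies at square roots of the x_j. *)
  have [D0|D0] := eqVneq (\prod_(j < k) (1 - x j)) 0.
    rewrite D0 mulr0 mul0r; apply: (mulfI W0); rewrite WE mulr0.
    move/eqP: D0; rewrite prodf_seq_eq0 => /hasP[j _ /=].
    rewrite subr_eq0 => /eqP xj; rewrite /half_alternant (expand_det_col _ j).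
    by rewrite big1 // => i _; rewrite !mxE -xj !expr1n subrr mul0r.
  pose y j := sqrtC (x j).
  have yx : (fun j => y j ^+ 2) = x by apply/funext => j; rewrite sqrtCK.
  have y0 j : y j != 0 by rewrite sqrtC_eq0.
  have H2 := det_pal_mx_half x hk.
  have H3 := SO_alternant_cross N y0; rewrite yx in H3.
  have yX : \prod_j y j ^+ 2 = \prod_(j < k) x j.
    by apply: eq_bigr => j _; rewrite sqrtCK.
  rewrite yX in H3.
  have H0n : half_alternant (1 + 2 * (k - 1)) x != 0.
    by rewrite -H2; apply: mulf_neq0.
  have alt0 : SO_alternant [::] y != 0.
    have := SO_alternant_half 0 y0; rewrite -SO_alternant_nil yx => h0.
    apply: contra_eqN h0 => /eqP ->; rewrite mul0r eq_sym.
    exact: mulf_neq0 (reversal_sign_neq0 R k) H0n.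
  have := P_char y y0 alt0; rewrite yx => ->.
  exact: (cross_mul W0 alt0 WE H2 H3).
split=> //; rewrite -EP; apply: (mulfI W0).
by rewrite WE half_alternant_expand.
Qed.
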